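(* Let $\varepsilon,m>0$. For every $\delta\in(0,1)$ there exists a unique pair of complex-valued functions $A_1(x,t)=A_1(x,t,m,\varepsilon,\delta)$, $A_2(x,t)=A_2(x,t,m,\varepsilon,\delta)$ on the set $L_\varepsilon:=\{(x,t)\in\mathbb{R}^2: 2x/\varepsilon,\ 2t/\varepsilon,\ (x+t)/\varepsilon\in\mathbb{Z}\}$ satisfying the following three axioms: (axiom 1) for each $(x,t)\in L_\varepsilon$ with $2x/\varepsilon$ and $2t/\varepsilon$ even, $$A_1(x,t)=\tfrac{1}{\sqrt{1+m^2\varepsilon^2}}\Big(A_1(x+\tfrac{\varepsilon}{2},t-\tfrac{\varepsilon}{2})+m\varepsilon\,A_2(x+\tfrac{\varepsilon}{2},t-\tfrac{\varepsilon}{2})\Big),$$ $$A_2(x,t)=\tfrac{1}{\sqrt{1+m^2\varepsilon^2}}\Big(A_2(x-\tfrac{\varepsilon}{2},t-\tfrac{\varepsilon}{2})-m\varepsilon\,A_1(x-\tfrac{\varepsilon}{2},t-\tfrac{\varepsilon}{2})\Big)+2\delta_{x0}\delta_{t0};$$ (axiom 2) for each $(x,t)\in L_\varepsilon$ with $2x/\varepsilon$ and $2t/\varepsilon$ odd, $$A_1(x,t)=\tfrac{1}{\sqrt{1-\delta^2}}\Big(A_1(x+\tfrac{\varepsilon}{2},t-\tfrac{\varepsilon}{2})-i\delta\,A_2(x+\tfrac{\varepsilon}{2},t-\tfrac{\varepsilon}{2})\Big),$$ $$A_2(x,t)=\tfrac{1}{\sqrt{1-\delta^2}}\Big(A_2(x-\tfrac{\varepsilon}{2},t-\tfrac{\varepsilon}{2})+i\delta\,A_1(x-\tfrac{\varepsilon}{2},t-\tfrac{\varepsilon}{2})\Big);$$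 (axiom 3) $\sum_{(x,t)\in\varepsilon\mathbb{Z}^2}\big(|A_1(x,t)|^2+|A_2(x,t)|^2\big)<\infty$. Moreover, for each $(x,t)\in\varepsilon\mathbb{Z}^2$ and $k\in\{1,2\}$ the limit $\widetilde{A}_k(x,t,m,\varepsilon):=\lim_{\delta\searrow0}A_k(x,t,m,\varepsilon,\delta)$ exists. If $(x+t)/\varepsilon+k$ is even, this limit is real and given by $$\widetilde{A}_1(x,t,m,\varepsilon)=a_1(x,|t|+\varepsilon,m,\varepsilon)\quad\text{for }(x+t)/\varepsilon\text{ odd},$$ $$\widetilde{A}_2(x,t,m,\varepsilon)=\pm a_2(\pm x+\varepsilon,|t|+\varepsilon,m,\varepsilon)\quad\text{for }(x+t)/\varepsilon\text{ even},$$ where both minus signs are taken when $t<0$ (and both plus signs when $t\ge0$). If $(x+t)/\varepsilon+k$ is odd, the limit is purely imaginary.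
   Context: $\delta_{xy}$ denotes the Kronecker delta ($1$ if $x=y$, $0$ otherwise). Feynman checkers: for $\varepsilon>0$, $m\ge0$, a checker path $s$ is a finite sequence of points of $\varepsilon\mathbb{Z}^2$ such that the vector from each point (except the last) to the next equals $(\varepsilon,\varepsilon)$ or $(-\varepsilon,\varepsilon)$; $\mathrm{turns}(s)$ is the number of points of $s$, other than the first and last, at which the vectors to the next point and from the previous point are orthogonal. Set $a(s):=(1+m^2\varepsilon^2)^{1-n/2}\,i\,(-im\varepsilon)^{\mathrm{turns}(s)}$, where $n$ is the number of points of $s$. For $(x,t)\in\varepsilon\mathbb{Z}^2$ with $t>0$, $a(x,t,m,\varepsilon):=\sum_s a(s)$ over all checker paths from $(0,0)$ to $(x,t)$ containing $(\varepsilon,\varepsilon)$ (empty sum is $0$), and $a_1:=\mathrm{Re}\,a$, $a_2:=\mathrm{Im}\,a$. *)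

(* Defs.v *)
From Stdlib Require Import Reals ZArith List Lra.
From Coquelicot Require Import Coquelicot.
Import ListNotations.
Open Scope R_scope.

(* all bool sequences of length n; true = step (+eps,+eps), false = (-eps,+eps) *)
Fixpoint bool_lists (n : nat) : list (list bool) :=
  match n with
  | O => [nil]
  | S k => map (cons true) (bool_lists k) ++ map (cons false) (bool_lists k)
  end.

Definition step (b : bool) : Z := if b then 1%Z else (-1)%Z.

(* horizontal displacement (in units of eps) of the path with step sequence s *)
Fixpoint endpoint (s : list bool) : Z :=
  match s with nil => 0%Z | b :: r => (step b + endpoint r)%Z end.

Fixpoint turns (s : list bool) : nat :=
  match s with
  | b1 :: ((b2 :: _) as r) => ((if Bool.eqb b1 b2 then 0 else 1) + turns r)%nat
  | _ => 0%nat
  end.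

Fixpoint Cpow (z : C) (k : nat) : C :=
  match k with O => RtoC 1 | S j => Cmult z (Cpow z j) end.

(* a(s) for the checker path starting at (0,0) with step sequence s;
   the path has n = length s + 1 points *)
Definition path_amp (m eps : R) (s : list bool) : C :=
  Cmult (Cmult (RtoC (Rpower (1 + m ^ 2 * eps ^ 2) (1 - INR (S (length s)) / 2))) Ci)
        (Cpow (Cmult (Cmult (RtoC (-1)) Ci) (RtoC (m * eps))) (turns s)).

(* a(x,t,m,eps) at the point (x,t) = (eps*X, eps*T) of eps Z^2, T > 0:
   sum over checker paths from (0,0) to (x,t) passing through (eps,eps),
   i.e. step sequences of length T whose first step is (+eps,+eps) and
   whose horizontal displacement is X. *)
Definition checker_a (X T : Z) (m eps : R) : C :=
  fold_right Cplus (RtoC 0)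
    (map (path_amp m eps)
       (filter (fun s => match s with
                         | true :: _ => Z.eqb (endpoint s) X
                         | _ => false
                         end)
               (bool_lists (Z.to_nat T)))).

Definition a1 (X T : Z) (m eps : R) : R := Re (checker_a X T m eps).
Definition a2 (X T : Z) (m eps : R) : R := Im (checker_a X T m eps).

Definition kron (x y : R) : R := if Req_EM_T x y then 1 else 0.

(* The point of L_eps with coordinates (eps*X/2, eps*T/2); L_eps is exactly
   the set of such points with X + T even. *)
Definition hc (eps : R) (X : Z) : R := eps * IZR X / 2.

Definition axiom1 (eps m : R) (A1 A2 : R -> R -> C) : Prop :=
  forall X T : Z, Z.Even X -> Z.Even T ->
    let x := hc eps X in let t := hc eps T in
    A1 x t = Cmult (RtoC (1 / sqrt (1 + m ^ 2 * eps ^ 2)))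
               (Cplus (A1 (x + eps / 2) (t - eps / 2))
                      (Cmult (RtoC (m * eps)) (A2 (x + eps / 2) (t - eps / 2)))) /\
    A2 x t = Cplus
               (Cmult (RtoC (1 / sqrt (1 + m ^ 2 * eps ^ 2)))
                  (Cminus (A2 (x - eps / 2) (t - eps / 2))
                          (Cmult (RtoC (m * eps)) (A1 (x - eps / 2) (t - eps / 2)))))
               (RtoC (2 * kron x 0 * kron t 0)).

Definition axiom2 (eps delta : R) (A1 A2 : R -> R -> C) : Prop :=
  forall X T : Z, Z.Odd X -> Z.Odd T ->
    let x := hc eps X in let t := hc eps T in
    A1 x t = Cmult (RtoC (1 / sqrt (1 - delta ^ 2)))
               (Cminus (A1 (x + eps / 2) (t - eps / 2))
                       (Cmult (Cmult Ci (RtoC delta)) (A2 (x + eps / 2) (t - eps / 2)))) /\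
    A2 x t = Cmult (RtoC (1 / sqrt (1 - delta ^ 2)))
               (Cplus (A2 (x - eps / 2) (t - eps / 2))
                      (Cmult (Cmult Ci (RtoC delta)) (A1 (x - eps / 2) (t - eps / 2)))).

Definition zrange (N : nat) : list Z :=
  map (fun k => (Z.of_nat k - Z.of_nat N)%Z) (seq 0 (2 * N + 1)).

Definition sum_box (N : nat) (f : Z -> Z -> R) : R :=
  fold_right Rplus 0
    (map (fun X => fold_right Rplus 0 (map (fun T => f X T) (zrange N))) (zrange N)).

(* axiom 3: the series of nonnegative terms over eps Z^2 converges,
   i.e. its partial sums over the boxes [-N,N]^2 are bounded *)
Definition axiom3 (eps : R) (A1 A2 : R -> R -> C) : Prop :=
  exists M : R, forall N : nat,
    sum_box N (fun X T => Cmod (A1 (eps * IZR X) (eps * IZR T)) ^ 2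
                        + Cmod (A2 (eps * IZR X) (eps * IZR T)) ^ 2) <= M.

Definition axioms (eps m delta : R) (A1 A2 : R -> R -> C) : Prop :=
  axiom1 eps m A1 A2 /\ axiom2 eps delta A1 A2 /\ axiom3 eps A1 A2.

(* Main.v *)
(** Eliminating the half-integer points, the axioms become a one-step system on
    [eps Z^2] whose transfer matrix has determinant 1 and trace [2 c], where in the
    Fourier variable [c = r cos p + i v] with [v > 0]. So each component of a
    solution satisfies [u(t+1) + u(t-1) - 2 c u(t) = 0] away from the source. The
    imaginary part [2 v] makes the flux of a square-summable homogeneous solution
    strictly increasing, which forces uniqueness. The fundamental solution is the
    cosine transform of [(i / (2 s)) lam^|t|] with [s = sqrt (1 - c^2)] and
    [lam = c - i s], [|lam| < 1]; it is square-summable by Bessel's inequality.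
    As [delta] tends to 0, [c] becomes [n cos p] with [n < 1], so the transform
    stays continuous up to the limit. There the symmetry [p -> PI - p] separates real
    and imaginary values by the parity of [x + t], and the real part satisfies
    the first-step recursion of the checker paths. *)

Require Import Defs.
From Stdlib Require Import Reals ZArith List Lra Lia.
From Coquelicot Require Import Coquelicot.
Open Scope R_scope.

(** * Symmetric finite sums over Z *)

(** The transfer matrix is never diagonalised. A scalar fundamental solution becomes a solution of
    the two-component system through the adjugate of (time shift minus transfer matrix), whose
    second column is the pair [kernel_a], [kernel_b]. Since [lam] and [s] depend on [p] only through
    [cos p], real averages over [[0, PI]] take the place of complex Fourier series. The main
    obstacle is the pair of branch points [c = 1] and [c = -1]. For fixed [delta] the coefficient
    [r = n / sqrt (1 - delta^2)] may exceed 1, and only [v > 0] keeps [c] away from them; as [delta]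
    tends to 0, [v] vanishes and [n < 1], a consequence of [m * eps > 0], takes over. Hence the two
    alternatives in [sym_dom]. At [delta = 0] the root [lam] has modulus 1, so the decay in [t]
    behind axiom 3 is lost. The limit is therefore taken in the explicit formula, and uniqueness for
    each [delta > 0] carries it over to an arbitrary family of solutions. *)

Definition zsum (N : nat) (g : Z -> R) : R := fold_right Rplus 0 (map g (zrange N)).

Lemma zrange_S (N : nat) :
  zrange (S N) =
  (- Z.of_nat (S N))%Z :: zrange N ++ (Z.of_nat (S N) :: nil).
Proof.
unfold zrange.
replace (2 * S N + 1)%nat with (S (2 * N + 1 + 1)) by lia.
rewrite <- cons_seq, seq_app, map_cons, map_app.
f_equal.
f_equal; [|cbn [map seq]; f_equal; lia].
rewrite <- seq_shift, map_map; apply map_ext; intros; lia.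
Qed.

Lemma zsum_O (g : Z -> R) : zsum 0 g = g 0%Z.
Proof. unfold zsum, zrange; simpl; ring. Qed.

Lemma zsum_S (N : nat) (g : Z -> R) :
  zsum (S N) g = zsum N g + g (Z.of_nat (S N)) + g (- Z.of_nat (S N))%Z.
Proof.
unfold zsum; rewrite zrange_S, map_cons, map_app, <- (Rplus_0_r (fold_right _ _ (map g (zrange N)))).
cbn [fold_right]; rewrite fold_right_app; cbn [map fold_right].
generalize (zrange N); intros l; induction l as [|a l IH]; cbn [map fold_right] in *; lra.
Qed.

Lemma sum_box_zsum (N : nat) (f : Z -> Z -> R) :
  sum_box N f = zsum N (fun X => zsum N (fun T => f X T)).
Proof. reflexivity. Qed.

Lemma zsum_ext_in (N : nat) (f g : Z -> R) :
  (forall x, (Z.abs x <= Z.of_nat N)%Z -> f x = g x) -> zsum N f = zsum N g.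
Proof.
induction N as [|N IH]; intros H.
- rewrite !zsum_O; apply H; lia.
- rewrite !zsum_S, IH, (H (Z.of_nat (S N))), (H (- Z.of_nat (S N))%Z); try lia; [ring|].
  intros; apply H; lia.
Qed.

Lemma zsum_ext (N : nat) (f g : Z -> R) : (forall x, f x = g x) -> zsum N f = zsum N g.
Proof. intros H; apply zsum_ext_in; intros; apply H. Qed.

Lemma zsum_plus (N : nat) (f g : Z -> R) : zsum N (fun x => f x + g x) = zsum N f + zsum N g.
Proof. induction N as [|N IH]; rewrite ?zsum_O, ?zsum_S; lra. Qed.

Lemma zsum_scal (N : nat) (c : R) (f : Z -> R) : zsum N (fun x => c * f x) = c * zsum N f.
Proof. induction N as [|N IH]; rewrite ?zsum_O, ?zsum_S; [ring|rewrite IH; ring]. Qed.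

Lemma zsum_le (N : nat) (f g : Z -> R) : (forall x, f x <= g x) -> zsum N f <= zsum N g.
Proof.
intros H; induction N as [|N IH]; rewrite ?zsum_O, ?zsum_S; [apply H|].
generalize (H (Z.of_nat (S N))) (H (- Z.of_nat (S N))%Z); lra.
Qed.

Lemma zsum_const0 (N : nat) : zsum N (fun _ => 0) = 0.
Proof. induction N as [|N IH]; rewrite ?zsum_O, ?zsum_S; lra. Qed.

Lemma zsum_nonneg (N : nat) (f : Z -> R) : (forall x, 0 <= f x) -> 0 <= zsum N f.
Proof. intros H; rewrite <- (zsum_const0 N); apply zsum_le, H. Qed.

Lemma zsum_leS (N : nat) (f : Z -> R) : (forall x, 0 <= f x) -> zsum N f <= zsum (S N) f.
Proof.
intros H; rewrite zsum_S; generalize (H (Z.of_nat (S N))) (H (- Z.of_nat (S N))%Z); lra.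
Qed.

Lemma zsum_ge_term (N : nat) (f : Z -> R) (x : Z) :
  (forall x, 0 <= f x) -> (Z.abs x <= Z.of_nat N)%Z -> f x <= zsum N f.
Proof.
intros H; induction N as [|N IH]; intros Hx.
- rewrite zsum_O; replace x with 0%Z by lia; lra.
- destruct (Z_le_gt_dec (Z.abs x) (Z.of_nat N)) as [h|h].
  + generalize (IH h) (zsum_leS N f H); lra.
  + rewrite zsum_S; generalize (zsum_nonneg N f H) (H (Z.of_nat (S N))) (H (- Z.of_nat (S N))%Z).
    destruct (Z_le_gt_dec 0 x) as [h'|h'].
    * replace x with (Z.of_nat (S N)) by lia; lra.
    * replace x with (- Z.of_nat (S N))%Z by lia; lra.
Qed.

Lemma zsum_swap (N M : nat) (f : Z -> Z -> R) :
  zsum N (fun x => zsum M (fun y => f x y)) = zsum M (fun y => zsum N (fun x => f x y)).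
Proof.
induction N as [|N IH].
- rewrite zsum_O; apply zsum_ext; intros; rewrite zsum_O; reflexivity.
- rewrite zsum_S, IH, <- !zsum_plus; apply zsum_ext; intros; rewrite zsum_S; reflexivity.
Qed.

Lemma zsum_telescope (N : nat) (j : Z -> R) :
  zsum N (fun x => j x - j (x - 1)%Z) = j (Z.of_nat N) - j (- Z.of_nat N - 1)%Z.
Proof.
induction N as [|N IH]; rewrite ?zsum_O, ?zsum_S, ?IH; [reflexivity|].
replace (Z.of_nat (S N) - 1)%Z with (Z.of_nat N) by lia.
replace (- Z.of_nat (S N))%Z with (- Z.of_nat N - 1)%Z by lia; ring.
Qed.

Lemma zsum_delta (N : nat) (y : Z) (g : Z -> R) :
  (Z.abs y <= Z.of_nat N)%Z -> zsum N (fun x => if Z.eq_dec x y then g x else 0) = g y.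
Proof.
revert y; induction N as [|N IH]; intros y Hy.
- rewrite zsum_O; destruct (Z.eq_dec 0 y) as [<-|h]; [reflexivity|lia].
- rewrite zsum_S.
  destruct (Z_le_gt_dec (Z.abs y) (Z.of_nat N)) as [h|h].
  + rewrite IH by exact h.
    destruct (Z.eq_dec (Z.of_nat (S N)) y); [lia|].
    destruct (Z.eq_dec (- Z.of_nat (S N)) y); [lia|ring].
  + rewrite (zsum_ext_in N _ (fun _ => 0)), zsum_const0
      by (intros x hx; destruct (Z.eq_dec x y); [lia|reflexivity]).
    destruct (Z.eq_dec (Z.of_nat (S N)) y) as [<-|h1];
    destruct (Z.eq_dec (- Z.of_nat (S N)) _) as [h2|h2]; try lia; try ring.
    rewrite h2; ring.
Qed.

Lemma zsum_shift (N : nat) (f : Z -> R) :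
  (forall x, 0 <= f x) -> zsum N (fun x => f (x + 1)%Z) <= zsum (S N) f.
Proof.
intros H.
assert (E : zsum N (fun x => f (x + 1)%Z) =
  zsum N f + (f (Z.of_nat N + 1)%Z - f (- Z.of_nat N)%Z)).
{ rewrite (zsum_ext N (fun x => f (x + 1)%Z)
    (fun x => f x + (f (x + 1)%Z - f (x - 1 + 1)%Z))).
  - rewrite zsum_plus; f_equal; rewrite (zsum_telescope N (fun x => f (x + 1)%Z)).
    do 2 f_equal; f_equal; lia.
  - intros x; replace (x - 1 + 1)%Z with x by lia; ring. }
rewrite E, zsum_S; replace (Z.of_nat (S N)) with (Z.of_nat N + 1)%Z by lia.
generalize (H (- Z.of_nat N)%Z) (H (- (Z.of_nat N + 1))%Z); lra.
Qed.

(** The four corners of the shell are counted in the columns: [zsum N] for the rows, [zsum (S N)]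
    for the columns. *)
Lemma sum_box_S (N : nat) (f : Z -> Z -> R) :
  sum_box (S N) f = sum_box N f
    + zsum N (fun x => f x (Z.of_nat (S N)) + f x (- Z.of_nat (S N))%Z)
    + zsum (S N) (fun t => f (Z.of_nat (S N)) t + f (- Z.of_nat (S N))%Z t).
Proof.
rewrite !sum_box_zsum, zsum_S, (zsum_plus (S N) (fun T => f (Z.of_nat (S N)) T) (fun T => f (- Z.of_nat (S N))%Z T)).
rewrite (zsum_ext N (fun X => zsum (S N) (fun T => f X T))
  (fun X => zsum N (fun T => f X T) + (f X (Z.of_nat (S N)) + f X (- Z.of_nat (S N))%Z))).
- rewrite (zsum_plus N (fun X => zsum N (fun T => f X T)) (fun X => f X (Z.of_nat (S N)) + f X (- Z.of_nat (S N))%Z)). ring.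
- intros; rewrite zsum_S; ring.
Qed.

Lemma sum_box_swap (N : nat) (f : Z -> Z -> R) : sum_box N f = sum_box N (fun x t => f t x).
Proof. rewrite !sum_box_zsum; apply zsum_swap. Qed.

Lemma sum_box_plus (N : nat) (f g : Z -> Z -> R) :
  sum_box N (fun x t => f x t + g x t) = sum_box N f + sum_box N g.
Proof.
rewrite !sum_box_zsum, <- zsum_plus; apply zsum_ext; intros; apply zsum_plus.
Qed.

Lemma sum_box_scal (N : nat) (c : R) (f : Z -> Z -> R) :
  sum_box N (fun x t => c * f x t) = c * sum_box N f.
Proof.
rewrite !sum_box_zsum, <- zsum_scal; apply zsum_ext; intros; apply zsum_scal.
Qed.

Lemma sum_box_le (N : nat) (f g : Z -> Z -> R) :
  (forall x t, f x t <= g x t) -> sum_box N f <= sum_box N g.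
Proof. intros H; rewrite !sum_box_zsum; apply zsum_le; intros; apply zsum_le, H. Qed.

Lemma sum_box_ext (N : nat) (f g : Z -> Z -> R) :
  (forall x t, f x t = g x t) -> sum_box N f = sum_box N g.
Proof. intros H; rewrite !sum_box_zsum; apply zsum_ext; intros; apply zsum_ext, H. Qed.

Lemma sum_box_telescope (N : nat) (j : Z -> Z -> R) :
  sum_box N (fun x t => j x t - j x (t - 1)%Z) =
  zsum N (fun x => j x (Z.of_nat N) - j x (- Z.of_nat N - 1)%Z).
Proof. rewrite sum_box_zsum; apply zsum_ext; intros x; apply (zsum_telescope N (j x)). Qed.

Lemma sum_box_ge_term (N : nat) (f : Z -> Z -> R) (x t : Z) :
  (forall x t, 0 <= f x t) -> (Z.abs x <= Z.of_nat N)%Z -> (Z.abs t <= Z.of_nat N)%Z ->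
  f x t <= sum_box N f.
Proof.
intros H hx ht; rewrite sum_box_zsum.
apply Rle_trans with (zsum N (fun T => f x T)).
- apply (zsum_ge_term N (fun T => f x T)); [intros; apply H|exact ht].
- apply (zsum_ge_term N (fun X => zsum N (fun T => f X T))); [|exact hx].
  intros; apply zsum_nonneg; intros; apply H.
Qed.

(** * Square-summable solutions of the homogeneous scalar equation vanish *)

(** The operator [u(t+1) + u(t-1) - 2 c u(t)] before the Fourier transform: [2 c] splits into real
    hopping with coefficient [r] and the imaginary constant [k], which is [2 v]. *)
Definition scalar_op (r k : R) (u : Z -> Z -> C) (x t : Z) : C :=
  (u x (t + 1)%Z + u x (t - 1)%Z - RtoC r * (u (x + 1)%Z t + u (x - 1)%Z t)
   - Ci * RtoC k * u x t)%C.

(** The discrete current between two neighbouring values. It changes sign when [z] and [w] are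
    exchanged, which lets the equation be read as a divergence. *)
Definition flux (z w : C) : R := Im (Cconj z * w).

Lemma flux_bound (z w : C) : Rabs (flux z w) <= (Cmod z ^ 2 + Cmod w ^ 2) / 2.
Proof.
rewrite !Cmod2_alt; destruct z as [a b], w as [c d]; unfold flux; simpl.
apply Rabs_le; generalize (pow2_ge_0 (a - d)) (pow2_ge_0 (b + c)) (pow2_ge_0 (a + d))
  (pow2_ge_0 (b - c)); lra.
Qed.

(** Multiply the equation by the conjugate of [u x t] and take imaginary parts. The term with [Ci]
    yields [k |u|^2]; the neighbour terms, having real coefficients, yield differences of
    currents. *)
Lemma scalar_op_flux (r k : R) (u : Z -> Z -> C) (x t : Z) :
  scalar_op r k u x t = 0%C ->
  k * Cmod (u x t) ^ 2 =
  (flux (u x t) (u x (t + 1)%Z) - flux (u x (t - 1)%Z) (u x t))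
  - r * (flux (u x t) (u (x + 1)%Z t) - flux (u (x - 1)%Z t) (u x t)).
Proof.
unfold scalar_op, flux; rewrite Cmod2_alt; intros H.
assert (H' : Im (Cconj (u x t) * 0)%C = 0) by (simpl; ring).
rewrite <- H in H'; revert H'; clear H.
destruct (u x t), (u x (t + 1)%Z), (u x (t - 1)%Z), (u (x + 1)%Z t), (u (x - 1)%Z t); simpl.
lra.
Qed.

(** Telescoping in [t] leaves only the currents between the levels [n], [n + 1] and between
    [- (n + 1)], [- n], with [n = N + 1]. All four levels lie in the shell between the boxes of
    sizes [N] and [N + 2]. *)
Lemma sum_box_flux (N : nat) (u : Z -> Z -> C) :
  let f := fun x t => Cmod (u x t) ^ 2 in
  Rabs (sum_box (S N) (fun x t => flux (u x t) (u x (t + 1)%Z) - flux (u x (t - 1)%Z) (u x t)))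
  <= sum_box (S (S N)) f - sum_box N f.
Proof.
intros f.
assert (f0 : forall x t, 0 <= f x t) by (intros; apply pow2_ge_0).
set (n := Z.of_nat (S N)).
rewrite (sum_box_ext (S N) _ (fun x t => flux (u x t) (u x (t + 1)%Z)
  - flux (u x (t - 1)%Z) (u x (t - 1 + 1)%Z)))
  by (intros; replace (t - 1 + 1)%Z with t by lia; reflexivity).
rewrite (sum_box_telescope (S N) (fun x t => flux (u x t) (u x (t + 1)%Z))).
apply Rle_trans with (zsum (S N) (fun x =>
  (f x n + f x (-n)%Z) + (f x (Z.of_nat (S (S N))) + f x (- Z.of_nat (S (S N)))%Z))).
- fold n; replace (Z.of_nat (S (S N))) with (n + 1)%Z by lia.
  assert (B : forall x, Rabs (flux (u x n) (u x (n + 1)%Z)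
     - flux (u x (- n - 1)%Z) (u x (- n - 1 + 1)%Z)) <=
     (f x n + f x (-n)%Z) + (f x (n + 1)%Z + f x (- (n + 1))%Z)).
  { intros x; replace (- n - 1)%Z with (- (n + 1))%Z by lia.
    replace (- (n + 1) + 1)%Z with (- n)%Z by lia.
    generalize (flux_bound (u x n) (u x (n + 1)%Z)) (flux_bound (u x (- (n + 1))%Z) (u x (- n)%Z)).
    fold (f x n) (f x (n+1)%Z) (f x (- (n + 1))%Z) (f x (- n)%Z).
    generalize (f0 x n) (f0 x (n+1)%Z) (f0 x (- (n + 1))%Z) (f0 x (- n)%Z).
    unfold Rabs; repeat destruct Rcase_abs; lra. }
  apply Rabs_le; split.
  + rewrite <- (Rmult_1_l (zsum _ _)), Ropp_mult_distr_l, <- zsum_scal; apply zsum_le; intros x.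
    generalize (B x); intros B'; apply Rabs_le_between in B'; lra.
  + apply zsum_le; intros x; generalize (B x); intros B'; apply Rabs_le_between in B'; lra.
- rewrite (sum_box_S (S N)), (sum_box_S N), (zsum_plus (S N)).
  fold n; rewrite (zsum_S N (fun x => f x n + f x (- n)%Z)); fold n.
  assert (0 <= zsum (S (S N)) (fun t => f (Z.of_nat (S (S N))) t + f (- Z.of_nat (S (S N)))%Z t)).
  { apply zsum_nonneg; intros t.
    generalize (f0 (Z.of_nat (S (S N))) t) (f0 (- Z.of_nat (S (S N)))%Z t); lra. }
  (* The rows at heights [n] and [- n] reach the four corners, which the decomposition of the box
     has assigned to the columns. *)
  assert (f n n + f (- n)%Z n + (f n (-n)%Z + f (- n)%Z (- n)%Z)
     <= zsum (S N) (fun t => f n t + f (- n)%Z t)).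
  { rewrite zsum_S; fold n.
    generalize (zsum_nonneg N (fun t => f n t + f (- n)%Z t)); intros Hn.
    enough (0 <= zsum N (fun t => f n t + f (- n)%Z t)) by lra.
    apply Hn; intros t; generalize (f0 n t) (f0 (-n)%Z t); lra. }
  lra.
Qed.

Lemma bounded_no_growth (S : nat -> R) (c M : R) (N0 : nat) :
  0 < c -> (forall N, S N <= M) -> (forall N, (N0 <= N)%nat -> S N + c <= S (N + 2)%nat) -> False.
Proof.
intros hc hM hS.
assert (G : forall n : nat, S N0 + INR n * c <= S (N0 + 2 * n)%nat).
{ induction n as [|n IH].
  - simpl; rewrite Nat.add_0_r; lra.
  - replace (N0 + 2 * Datatypes.S n)%nat with (N0 + 2 * n + 2)%nat by lia.
    generalize (hS (N0 + 2 * n)%nat ltac:(lia)); rewrite S_INR; lra. }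
destruct (INR_unbounded ((M - S N0) / c)) as [n hn].
generalize (G n) (hM (N0 + 2 * n)%nat); intros.
apply Rmult_gt_compat_r with (r := c) in hn; [|exact hc].
unfold Rdiv in hn; rewrite Rmult_assoc, Rinv_l in hn; lra.
Qed.

(* Summing the flux identity over a box bounds [k * sum_box] by the increments
   of the box sums, which tend to 0 for a square-summable [u]. *)
Lemma scalar_unique (r k M : R) (u : Z -> Z -> C) :
  0 < r -> 0 < k ->
  (forall x t, scalar_op r k u x t = 0%C) ->
  (forall N, sum_box N (fun x t => Cmod (u x t) ^ 2) <= M) ->
  forall x t, u x t = 0%C.
Proof.
intros hr hk Hu HM x t.
set (f := fun x t => Cmod (u x t) ^ 2).
assert (f0 : forall x t, 0 <= f x t) by (intros; apply pow2_ge_0).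
destruct (Req_dec (f x t) 0) as [h|h].
{ apply Cmod_eq_0; unfold f in h; nra. }
exfalso.
set (N0 := S (Z.to_nat (Z.max (Z.abs x) (Z.abs t)))).
assert (mono : forall N, sum_box N f <= sum_box (S N) f).
{ intros N; rewrite sum_box_S.
  assert (0 <= zsum N (fun x => f x (Z.of_nat (S N)) + f x (- Z.of_nat (S N))%Z)).
  { apply zsum_nonneg; intros y; generalize (f0 y (Z.of_nat (S N))) (f0 y (- Z.of_nat (S N))%Z); lra. }
  assert (0 <= zsum (S N) (fun t => f (Z.of_nat (S N)) t + f (- Z.of_nat (S N))%Z t)).
  { apply zsum_nonneg; intros y; generalize (f0 (Z.of_nat (S N)) y) (f0 (- Z.of_nat (S N))%Z y); lra. }
  lra. }
assert (step : forall N, k * sum_box (S N) f <= (1 + r) * (sum_box (S (S N)) f - sum_box N f)).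
{ intros N.
  rewrite <- sum_box_scal, (sum_box_ext (S N) (fun x t => k * f x t) (fun x t =>
    (flux (u x t) (u x (t + 1)%Z) - flux (u x (t - 1)%Z) (u x t))
    + (- r) * (flux (u x t) (u (x + 1)%Z t) - flux (u (x - 1)%Z t) (u x t)))).
  2: { intros y s; unfold f; rewrite (scalar_op_flux r k u y s) by apply Hu; ring. }
  rewrite sum_box_plus, sum_box_scal.
  (* Spatial currents are the temporal currents of the transposed function; the rewrites below
     transpose the boxes back. *)
  generalize (sum_box_flux N u) (sum_box_flux N (fun x t => u t x)); cbv zeta.
  rewrite <- (sum_box_swap (S (S N)) (fun x t => Cmod (u x t) ^ 2)), <- (sum_box_swap N (fun x t => Cmod (u x t) ^ 2)).
  rewrite <- (sum_box_swap (S N) (fun x t => flux (u x t) (u (x + 1)%Z t) - flux (u (x - 1)%Z t) (u x t))).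
  fold f; intros B1 B2.
  apply Rabs_le_between in B1; apply Rabs_le_between in B2; nra. }
(* Once [(x, t)] lies in the box of size [N + 1], [step] forces this fixed growth from size [N] to
   size [N + 2]. *)
apply (bounded_no_growth (fun N => sum_box N f) (k * f x t / (1 + r)) M N0).
- apply Rdiv_lt_0_compat; [|lra]; apply Rmult_lt_0_compat; [lra|].
  generalize (f0 x t); lra.
- exact HM.
- intros N hN; replace (N + 2)%nat with (S (S N)) by lia.
  assert (f x t <= sum_box (S N) f)
    by (apply sum_box_ge_term; [exact f0| |]; unfold N0 in hN; lia).
  generalize (step N); intros hs.
  assert (k * f x t / (1 + r) <= sum_box (S (S N)) f - sum_box N f); [|lra].
  apply Rmult_le_reg_r with (1 + r); [lra|].
  unfold Rdiv; rewrite Rmult_assoc, Rinv_l by lra; nra.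
Qed.

(** * Elimination of the half-integer points *)

(* The composition of axioms 2 and 1: a full time step between points of [eps Z^2], with source [g]. *)
Definition lattice_step (r mu d : R) (a b g : Z -> Z -> C) : Prop :=
  forall x t : Z,
    a x t = (RtoC r * (a (x + 1)%Z (t - 1)%Z - Ci * RtoC d * b (x + 1)%Z (t - 1)%Z
               + RtoC mu * b x (t - 1)%Z + Ci * RtoC mu * RtoC d * a x (t - 1)%Z))%C /\
    b x t = (RtoC r * (b (x - 1)%Z (t - 1)%Z + Ci * RtoC d * a (x - 1)%Z (t - 1)%Z
               - RtoC mu * a x (t - 1)%Z + Ci * RtoC mu * RtoC d * b x (t - 1)%Z) + g x t)%C.

Lemma Ci_sqr : (Ci * Ci = - (1))%C.
Proof. apply injective_projections; simpl; ring. Qed.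

(** The unit determinant of the transfer matrix, solved for its top monomial so that [ring] can use
    it as a rewriting rule. *)
Lemma norm_coef_C (r mu d : R) :
  r * r * (1 + mu * mu) * (1 - d * d) = 1 ->
  (RtoC r * RtoC r * RtoC mu * RtoC mu * RtoC d * RtoC d =
   RtoC r * RtoC r + RtoC r * RtoC r * RtoC mu * RtoC mu - RtoC r * RtoC r * RtoC d * RtoC d - 1)%C.
Proof. intros H; rewrite <- !RtoC_mult, <- RtoC_plus, <- !RtoC_minus; f_equal; lra. Qed.

Section Step.
Variables (r mu d : R) (Hr : r * r * (1 + mu * mu) * (1 - d * d) = 1).

(** Cayley-Hamilton for the transfer matrix, which has determinant 1 by [Hr]. *)
Lemma lattice_step_scalar (a b : Z -> Z -> C) :
  lattice_step r mu d a b (fun _ _ => 0%C) ->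
  forall x t, scalar_op r (2 * r * mu * d) a x t = 0%C /\
              scalar_op r (2 * r * mu * d) b x t = 0%C.
Proof.
intros H x t; unfold scalar_op; rewrite !RtoC_mult.
generalize (norm_coef_C r mu d Hr) Ci_sqr; intros HC HI.
destruct (H x (t + 1)%Z) as [A1 B1], (H x t) as [A0 B0].
destruct (H (x + 1)%Z t) as [Ap Bp], (H (x - 1)%Z t) as [Am Bm].
revert A1 B1 Ap Bp Am Bm.
replace (t + 1 - 1)%Z with t by lia; replace (x + 1 - 1)%Z with x by lia;
replace (x - 1 + 1)%Z with x by lia.
(* All values are now expressed through those at time [t - 1], where the claim is a polynomial
   identity modulo [Ci * Ci = -1] and the normalisation. *)
intros -> -> Ap Bp Am Bm; rewrite A0, B0, Ap, Bp, Am, Bm; split; ring [HC HI].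
Qed.

(** With [S] the time shift and [M] the transfer matrix, [kernel_a] and [kernel_b] are the two
    components of [adj(S - M)] applied to [(0, 2 K)]. *)
Definition kernel_a (K : Z -> Z -> C) (x t : Z) : C :=
  (2 * RtoC r * (RtoC mu * K x t - Ci * RtoC d * K (x + 1)%Z t))%C.

Definition kernel_b (K : Z -> Z -> C) (x t : Z) : C :=
  (2 * K x (t + 1)%Z
   - 2 * RtoC r * (K (x + 1)%Z t + Ci * RtoC mu * RtoC d * K x t))%C.

(** The product of [S - M] with its adjugate is [det(S - M) = S (S + S^-1 - 2 c)], that is,
    [scalar_op] one time step later. So the source of [K] reappears, doubled, in the second
    component alone. *)
Lemma kernel_step (K g : Z -> Z -> C) :
  (forall x t, scalar_op r (2 * r * mu * d) K x t = g x t) ->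
  lattice_step r mu d (kernel_a K) (kernel_b K) (fun x t => (2 * g x t)%C).
Proof.
intros H x t; unfold kernel_a, kernel_b; rewrite <- (H x t).
generalize (norm_coef_C r mu d Hr) Ci_sqr; intros HC HI.
unfold scalar_op in *; rewrite !RtoC_mult.
replace (t - 1 + 1)%Z with t by lia; replace (x - 1 + 1)%Z with x by lia.
split; ring [HC HI].
Qed.

End Step.

Definition point_src (x t : Z) : C :=
  if Z.eq_dec x 0 then if Z.eq_dec t 0 then 1%C else 0%C else 0%C.

Definition on_lattice (eps : R) (A : R -> R -> C) (x t : Z) : C :=
  A (eps * IZR x) (eps * IZR t).

Lemma hc_double (eps : R) (x : Z) : hc eps (2 * x) = eps * IZR x.
Proof. unfold hc; rewrite mult_IZR; field. Qed.

Lemma hc_plus (eps : R) (x : Z) : hc eps x + eps / 2 = hc eps (x + 1).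
Proof. unfold hc; rewrite plus_IZR; field. Qed.

Lemma hc_minus (eps : R) (x : Z) : hc eps x - eps / 2 = hc eps (x - 1).
Proof. unfold hc; rewrite minus_IZR; field. Qed.

Lemma kron_hc (eps : R) (x t : Z) : 0 < eps ->
  RtoC (2 * kron (hc eps (2 * x)) 0 * kron (hc eps (2 * t)) 0) = (2 * point_src x t)%C.
Proof.
intros he; rewrite !hc_double; unfold kron, point_src.
assert (Hz : forall z, eps * IZR z = 0 <-> z = 0%Z).
{ intros z; split; [|intros ->; ring].
  intros h; apply Rmult_integral in h; destruct h as [h|h]; [lra|].
  apply eq_IZR; exact h. }
destruct (Req_EM_T (eps * IZR x) 0) as [h|h], (Z.eq_dec x 0) as [h'|h'];
  try (exfalso; generalize (Hz x); tauto);
destruct (Req_EM_T (eps * IZR t) 0) as [k|k], (Z.eq_dec t 0) as [k'|k'];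
  try (exfalso; generalize (Hz t); tauto); rewrite !RtoC_mult; ring.
Qed.

Section HalfLattice.
Variables (eps m d : R) (heps : 0 < eps) (hd : 0 < d < 1).
Let n := 1 / sqrt (1 + m ^ 2 * eps ^ 2).
Let e := 1 / sqrt (1 - d ^ 2).
Let r := n * e.

Lemma axioms_step (A B : R -> R -> C) :
  axioms eps m d A B ->
  lattice_step r (m * eps) d (on_lattice eps A) (on_lattice eps B) (fun x t => (2 * point_src x t)%C).
Proof.
intros [H1 [H2 _]] x t; unfold on_lattice; rewrite <- !(hc_double eps).
rewrite <- (kron_hc eps x t heps).
destruct (H1 (2 * x)%Z (2 * t)%Z) as [-> ->]; try (eexists; reflexivity).
fold n; rewrite !hc_plus, !hc_minus.
destruct (H2 (2 * x + 1)%Z (2 * t - 1)%Z) as [-> ->];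
  [exists x; lia|exists (t - 1)%Z; lia|].
destruct (H2 (2 * x - 1)%Z (2 * t - 1)%Z) as [-> ->];
  [exists (x - 1)%Z; lia|exists (t - 1)%Z; lia|].
fold e; rewrite !hc_plus, !hc_minus.
replace (2 * t - 1 - 1)%Z with (2 * (t - 1))%Z by lia.
replace (2 * x + 1 + 1)%Z with (2 * (x + 1))%Z by lia.
replace (2 * x + 1 - 1)%Z with (2 * x)%Z by lia.
replace (2 * x - 1 + 1)%Z with (2 * x)%Z by lia.
replace (2 * x - 1 - 1)%Z with (2 * (x - 1))%Z by lia.
unfold r; rewrite (RtoC_mult n e), !(RtoC_mult m eps).
generalize Ci_sqr; intros HI; split; ring [HI].
Qed.

(** The axioms speak of functions of real arguments, so the integer index has to be recovered from
    the coordinate. This is exact at the points [hc eps X], the only ones where the axioms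
    evaluate. *)
Definition half_index (x : R) : Z := Int_part (2 * x / eps).

Lemma half_index_hc (x : Z) : half_index (hc eps x) = x.
Proof.
unfold half_index, hc; symmetry; apply Int_part_spec.
replace (2 * (eps * IZR x / 2) / eps) with (IZR x) by (field; lra); lra.
Qed.

(* Extension of lattice functions from [eps Z^2] to all of [L_eps]: axiom 2
   prescribes the values at the points with odd half-integer indices. *)
Definition extend_a (a b : Z -> Z -> C) (x t : R) : C :=
  let X := half_index x in let T := half_index t in
  if Z.even X then a (X / 2)%Z (T / 2)%Z
  else (RtoC e * (a ((X + 1) / 2)%Z ((T - 1) / 2)%Z
                  - Ci * RtoC d * b ((X + 1) / 2)%Z ((T - 1) / 2)%Z))%C.

Definition extend_b (a b : Z -> Z -> C) (x t : R) : C :=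
  let X := half_index x in let T := half_index t in
  if Z.even X then b (X / 2)%Z (T / 2)%Z
  else (RtoC e * (b ((X - 1) / 2)%Z ((T - 1) / 2)%Z
                  + Ci * RtoC d * a ((X - 1) / 2)%Z ((T - 1) / 2)%Z))%C.

Lemma extend_even (a b : Z -> Z -> C) (x t : Z) :
  extend_a a b (hc eps (2 * x)) (hc eps (2 * t)) = a x t /\
  extend_b a b (hc eps (2 * x)) (hc eps (2 * t)) = b x t.
Proof.
unfold extend_a, extend_b; rewrite !half_index_hc.
replace (Z.even (2 * x)) with true by (symmetry; apply Z.even_spec; exists x; reflexivity).
rewrite !(Z.mul_comm 2), !Z.div_mul by lia; split; reflexivity.
Qed.

Lemma extend_odd (a b : Z -> Z -> C) (x t : Z) :
  extend_a a b (hc eps (2 * x + 1)) (hc eps (2 * t + 1)) =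
    (RtoC e * (a (x + 1)%Z t - Ci * RtoC d * b (x + 1)%Z t))%C /\
  extend_b a b (hc eps (2 * x + 1)) (hc eps (2 * t + 1)) =
    (RtoC e * (b x t + Ci * RtoC d * a x t))%C.
Proof.
unfold extend_a, extend_b; rewrite !half_index_hc.
replace (Z.even (2 * x + 1)) with false
  by (rewrite Z.add_1_r, Z.even_succ, <- Z.negb_even, Z.even_mul; reflexivity).
replace (2 * x + 1 + 1)%Z with ((x + 1) * 2)%Z by lia.
replace (2 * x + 1 - 1)%Z with (x * 2)%Z by lia.
replace (2 * t + 1 - 1)%Z with (t * 2)%Z by lia.
rewrite !Z.div_mul by lia; split; reflexivity.
Qed.

(** Axiom 2 holds by construction of the extension; substituting it into axiom 1 leaves exactly
    [lattice_step]. *)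
Lemma extend_axioms (a b : Z -> Z -> C) (M : R) :
  lattice_step r (m * eps) d a b (fun x t => (2 * point_src x t)%C) ->
  (forall N, sum_box N (fun x t => Cmod (a x t) ^ 2 + Cmod (b x t) ^ 2) <= M) ->
  axioms eps m d (extend_a a b) (extend_b a b).
Proof.
intros H HM; split; [|split].
- intros X T [x ->] [t ->]; cbv zeta.
  rewrite (kron_hc eps x t heps), !hc_plus, !hc_minus.
  replace (2 * t - 1)%Z with (2 * (t - 1) + 1)%Z by lia.
  replace (2 * x - 1)%Z with (2 * (x - 1) + 1)%Z by lia.
  destruct (extend_even a b x t) as [-> ->].
  destruct (extend_odd a b x (t - 1)) as [-> ->].
  destruct (extend_odd a b (x - 1) (t - 1)) as [-> ->].
  replace (x - 1 + 1)%Z with x by lia.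
  destruct (H x t) as [-> ->]; fold n; unfold r.
  rewrite (RtoC_mult n e), !(RtoC_mult m eps); generalize Ci_sqr; intros HI.
  split; ring [HI].
- intros X T [x ->] [t ->]; cbv zeta; fold e.
  destruct (extend_odd a b x t) as [-> ->].
  rewrite !hc_plus, !hc_minus.
  replace (2 * x + 1 + 1)%Z with (2 * (x + 1))%Z by lia.
  replace (2 * x + 1 - 1)%Z with (2 * x)%Z by lia.
  replace (2 * t + 1 - 1)%Z with (2 * t)%Z by lia.
  destruct (extend_even a b (x + 1) t) as [-> ->].
  destruct (extend_even a b x t) as [-> ->].
  split; reflexivity.
- exists M; intros N.
  eapply Rle_trans; [|apply (HM N)]; apply Req_le, sum_box_ext; intros x t.
  rewrite <- !(hc_double eps); destruct (extend_even a b x t) as [-> ->]; reflexivity.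
Qed.

Lemma axioms_odd_unique (A B A' B' : R -> R -> C) :
  axioms eps m d A B -> axioms eps m d A' B' ->
  (forall x t, on_lattice eps A x t = on_lattice eps A' x t /\
               on_lattice eps B x t = on_lattice eps B' x t) ->
  forall X T : Z, Z.Even (X + T) ->
    A (hc eps X) (hc eps T) = A' (hc eps X) (hc eps T) /\
    B (hc eps X) (hc eps T) = B' (hc eps X) (hc eps T).
Proof.
unfold on_lattice; intros [_ [H _]] [_ [H' _]] E X T hXT.
assert (E' : forall x t, A (hc eps (2 * x)) (hc eps (2 * t)) = A' (hc eps (2 * x)) (hc eps (2 * t))
   /\ B (hc eps (2 * x)) (hc eps (2 * t)) = B' (hc eps (2 * x)) (hc eps (2 * t)))
  by (intros; rewrite !hc_double; apply E).
destruct (Z.Even_or_Odd X) as [[x ->]|[x ->]], (Z.Even_or_Odd T) as [[t ->]|[t ->]].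
- apply E'.
- destruct hXT; lia.
- destruct hXT; lia.
- destruct (H (2 * x + 1)%Z (2 * t + 1)%Z) as [-> ->]; try (eexists; reflexivity).
  destruct (H' (2 * x + 1)%Z (2 * t + 1)%Z) as [-> ->]; try (eexists; reflexivity).
  rewrite !hc_plus, !hc_minus.
  replace (2 * x + 1 + 1)%Z with (2 * (x + 1))%Z by lia.
  replace (2 * x + 1 - 1)%Z with (2 * x)%Z by lia.
  replace (2 * t + 1 - 1)%Z with (2 * t)%Z by lia.
  destruct (E' (x + 1)%Z t) as [-> ->], (E' x t) as [-> ->].
  split; reflexivity.
Qed.

(** This is the hypothesis [Hr] of the preceding section: the two square roots normalise the
    transfer matrix to determinant 1. *)
Lemma amplitude_coef : r * r * (1 + m * eps * (m * eps)) * (1 - d * d) = 1.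
Proof.
unfold r, n, e.
assert (0 <= m ^ 2 * eps ^ 2) by (apply Rmult_le_pos; apply pow2_ge_0).
assert (h1 : 0 < sqrt (1 + m ^ 2 * eps ^ 2)) by (apply sqrt_lt_R0; lra).
assert (h2 : 0 < 1 - d ^ 2) by nra.
assert (h3 : 0 < sqrt (1 - d ^ 2)) by (apply sqrt_lt_R0; lra).
replace (1 + m * eps * (m * eps)) with (sqrt (1 + m ^ 2 * eps ^ 2) * sqrt (1 + m ^ 2 * eps ^ 2))
  by (rewrite sqrt_sqrt by lra; ring).
replace (1 - d * d) with (sqrt (1 - d ^ 2) * sqrt (1 - d ^ 2)) by (rewrite sqrt_sqrt by lra; ring).
field; lra.
Qed.

Lemma amplitude_coef_pos : 0 < r.
Proof.
assert (0 <= m ^ 2 * eps ^ 2) by (apply Rmult_le_pos; apply pow2_ge_0).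
assert (0 < 1 - d ^ 2) by nra.
apply Rmult_lt_0_compat; apply Rdiv_lt_0_compat; try lra; apply sqrt_lt_R0; lra.
Qed.

Lemma Cmod_minus_sqr (z w : C) : Cmod (z - w) ^ 2 <= 2 * (Cmod z ^ 2 + Cmod w ^ 2).
Proof.
rewrite !Cmod2_alt; destruct z as [a b], w as [a' b']; simpl.
generalize (pow2_ge_0 (a + a')) (pow2_ge_0 (b + b')); lra.
Qed.

(** The source cancels in the difference of two solutions, and [m], [eps], [d] being positive makes
    the constant [k] of [scalar_unique] positive for both components. *)
Lemma axioms_lattice_unique (A B A' B' : R -> R -> C) :
  0 < m -> axioms eps m d A B -> axioms eps m d A' B' ->
  forall x t, on_lattice eps A x t = on_lattice eps A' x t /\
              on_lattice eps B x t = on_lattice eps B' x t.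
Proof.
intros hm HA HA'.
generalize (axioms_step A B HA) (axioms_step A' B' HA'); intros SA SA'.
destruct HA as [_ [_ [M HM]]], HA' as [_ [_ [M' HM']]].
set (u := fun x t => (on_lattice eps A x t - on_lattice eps A' x t)%C).
set (v := fun x t => (on_lattice eps B x t - on_lattice eps B' x t)%C).
assert (S : lattice_step r (m * eps) d u v (fun _ _ => 0%C)).
{ intros x t; unfold u, v.
  destruct (SA x t) as [-> ->], (SA' x t) as [-> ->]; split; ring. }
assert (Buv : forall N, sum_box N (fun x t => Cmod (u x t) ^ 2 + Cmod (v x t) ^ 2) <= 2 * (M + M')).
{ intros N; apply Rle_trans with (sum_box N (fun x t => 2 * (
    (Cmod (on_lattice eps A x t) ^ 2 + Cmod (on_lattice eps B x t) ^ 2) +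
    (Cmod (on_lattice eps A' x t) ^ 2 + Cmod (on_lattice eps B' x t) ^ 2)))).
  - apply sum_box_le; intros x t.
    generalize (Cmod_minus_sqr (on_lattice eps A x t) (on_lattice eps A' x t))
      (Cmod_minus_sqr (on_lattice eps B x t) (on_lattice eps B' x t)); unfold u, v; lra.
  - rewrite sum_box_scal, sum_box_plus; apply Rmult_le_compat_l; [lra|].
    apply Rplus_le_compat; [apply HM|apply HM']. }
assert (hk : 0 < 2 * r * (m * eps) * d).
{ generalize amplitude_coef_pos (Rmult_lt_0_compat m eps hm heps); intros hr hme.
  apply Rmult_lt_0_compat; [|lra]; apply Rmult_lt_0_compat; [lra|exact hme]. }
generalize (lattice_step_scalar r (m * eps) d amplitude_coef u v S); intros Sc.
assert (Hu : forall x t, u x t = 0%C).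
{ apply (scalar_unique r _ (2 * (M + M')) u amplitude_coef_pos hk); [intros; apply Sc|].
  intros N; eapply Rle_trans; [|apply (Buv N)]; apply sum_box_le; intros x t.
  generalize (pow2_ge_0 (Cmod (v x t))); lra. }
assert (Hv : forall x t, v x t = 0%C).
{ apply (scalar_unique r _ (2 * (M + M')) v amplitude_coef_pos hk); [intros; apply Sc|].
  intros N; eapply Rle_trans; [|apply (Buv N)]; apply sum_box_le; intros x t.
  generalize (pow2_ge_0 (Cmod (u x t))); lra. }
assert (Z0 : forall z w : C, (z - w)%C = 0%C -> z = w).
{ intros z w h; replace z with (z - w + w)%C by ring; rewrite h; ring. }
intros x t; split; apply Z0; [apply Hu|apply Hv].
Qed.

End HalfLattice.

(** * Cosine coefficients *)

Definition avg (g : R -> R) : R := RInt g 0 PI / PI.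

Definition cont (g : R -> R) : Prop := forall p, continuous g p.

Lemma cont_integrable (g : R -> R) : cont g -> ex_RInt g 0 PI.
Proof. intros H; apply (ex_RInt_continuous (V := R_CompleteNormedModule)); intros; apply H. Qed.

Lemma cont_const (c : R) : cont (fun _ => c).
Proof. intros p; apply continuous_const. Qed.

Lemma cont_plus (f g : R -> R) : cont f -> cont g -> cont (fun p => f p + g p).
Proof. intros hf hg p; apply (continuous_plus f g); [apply hf|apply hg]. Qed.

Lemma cont_mult (f g : R -> R) : cont f -> cont g -> cont (fun p => f p * g p).
Proof. intros hf hg p; apply (continuous_mult f g); [apply hf|apply hg]. Qed.

Lemma cont_cos (c : R) : cont (fun p => cos (c * p)).
Proof.
intros p; apply continuous_comp; [|apply continuous_cos].
apply (cont_mult (fun _ => c) (fun p => p)); [apply cont_const|intros q; apply continuous_id].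
Qed.

Lemma cont_ext (f g : R -> R) : (forall p, f p = g p) -> cont f -> cont g.
Proof. intros H hf p; apply (continuous_ext f); [exact H|apply hf]. Qed.

Lemma cont_sqr (f : R -> R) : cont f -> cont (fun p => f p ^ 2).
Proof.
intros hf; apply (cont_ext (fun p => f p * f p)); [intros; ring|].
apply cont_mult; assumption.
Qed.

Ltac contR := repeat (assumption || lazymatch goal with
| |- cont (fun p => cos (_ * p)) => apply cont_cos
| |- cont (fun p => _ + _) => apply cont_plus
| |- cont (fun p => _ * _) => apply cont_mult
| |- cont (fun p => _ ^ 2) => apply cont_sqr
| |- cont _ => apply cont_const
end).

Lemma avg_ext (f g : R -> R) : (forall p, f p = g p) -> avg f = avg g.
Proof. intros H; unfold avg; f_equal; apply RInt_ext; intros; apply H. Qed.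

Lemma avg_plus (f g : R -> R) : cont f -> cont g -> avg (fun p => f p + g p) = avg f + avg g.
Proof.
intros hf hg; unfold avg, Rdiv; rewrite <- Rmult_plus_distr_r; f_equal.
apply (RInt_plus (V := R_CompleteNormedModule) f g); apply cont_integrable; assumption.
Qed.

Lemma avg_scal (c : R) (f : R -> R) : cont f -> avg (fun p => c * f p) = c * avg f.
Proof.
intros hf; unfold avg, Rdiv; rewrite <- Rmult_assoc; f_equal.
apply (RInt_scal (V := R_CompleteNormedModule) f); apply cont_integrable, hf.
Qed.

Lemma avg_le (f g : R -> R) :
  cont f -> cont g -> (forall p, 0 <= p <= PI -> f p <= g p) -> avg f <= avg g.
Proof.
intros hf hg H; generalize PI_RGT_0; intros hpi.
apply Rmult_le_compat_r; [apply Rlt_le, Rinv_0_lt_compat; lra|].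
apply RInt_le; [lra|apply cont_integrable, hf|apply cont_integrable, hg|].
intros; apply H; lra.
Qed.

Lemma avg_const (c : R) : avg (fun _ => c) = c.
Proof.
unfold avg; rewrite RInt_const; unfold scal; simpl; unfold mult; simpl.
generalize PI_RGT_0; intros; field; lra.
Qed.

Lemma avg_cos (k : Z) : avg (fun p => cos (IZR k * p)) = if Z.eq_dec k 0 then 1 else 0.
Proof.
destruct (Z.eq_dec k 0) as [->|h].
- rewrite (avg_ext _ (fun _ => 1)); [apply avg_const|].
  intros; rewrite Rmult_0_l; apply cos_0.
- assert (hk : IZR k <> 0) by (apply not_0_IZR; exact h).
  unfold avg.
  rewrite (is_RInt_unique _ _ _ _ (is_RInt_derive (V := R_CompleteNormedModule) (fun p => sin (IZR k * p) / IZR k) (fun p => cos (IZR k * p))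
    0 PI ltac:(intros; auto_derive; [exact I|field; exact hk]) ltac:(intros; apply cont_cos))).
  unfold minus, plus, opp; simpl.
  rewrite Rmult_0_r, sin_0, sin_eq_0_1 by (exists k; reflexivity).
  unfold Rdiv; ring.
Qed.

(** The Fourier coefficient of the even [2 PI]-periodic extension of [g] from [[0, PI]]. It is
    indexed by all of [Z] and normalised as a mean, so the constant 1 has coefficient 1 at 0 and 0
    elsewhere. *)
Definition coef (g : R -> R) (x : Z) : R := avg (fun p => cos (IZR x * p) * g p).

Lemma coef_ext (f g : R -> R) (x : Z) : (forall p, f p = g p) -> coef f x = coef g x.
Proof. intros H; apply avg_ext; intros; rewrite H; reflexivity. Qed.

Lemma coef_opp (g : R -> R) (x : Z) : coef g (- x) = coef g x.
Proof.
apply avg_ext; intros p; rewrite opp_IZR, <- Ropp_mult_distr_l, cos_neg; reflexivity.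
Qed.

Lemma coef_cos (x y : Z) :
  coef (fun p => cos (IZR y * p)) x =
  / 2 * ((if Z.eq_dec x y then 1 else 0) + (if Z.eq_dec x (- y) then 1 else 0)).
Proof.
unfold coef; rewrite (avg_ext _ (fun p => / 2 * (cos (IZR (x - y) * p) + cos (IZR (x + y) * p)))).
2: { intros p; rewrite plus_IZR, minus_IZR, Rmult_minus_distr_r, Rmult_plus_distr_r,
       cos_minus, cos_plus; field. }
rewrite avg_scal, avg_plus, !avg_cos; contR.
f_equal; f_equal; repeat destruct Z.eq_dec; try lia; reflexivity.
Qed.

Lemma cont_zsum (N : nat) (f : Z -> R -> R) :
  (forall x, cont (f x)) -> cont (fun p => zsum N (fun x => f x p)).
Proof.
intros H; induction N as [|N IH].
- intros p; apply (continuous_ext (f 0%Z)); [intros; rewrite zsum_O; reflexivity|apply H].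
- intros p; apply (continuous_ext (fun p => zsum N (fun x => f x p) + f (Z.of_nat (S N)) p + f (- Z.of_nat (S N))%Z p)).
  + intros; rewrite zsum_S; reflexivity.
  + apply cont_plus; [apply cont_plus|]; auto.
Qed.

Lemma avg_zsum (N : nat) (f : Z -> R -> R) :
  (forall x, cont (f x)) -> avg (fun p => zsum N (fun x => f x p)) = zsum N (fun x => avg (f x)).
Proof.
intros H; induction N as [|N IH].
- rewrite zsum_O; apply avg_ext; intros; apply zsum_O.
- rewrite zsum_S, <- IH, <- !avg_plus; auto using cont_zsum.
  + apply avg_ext; intros; apply zsum_S.
  + apply cont_plus; auto using cont_zsum.
Qed.

(** Expand the nonnegative mean of [(g - h)^2], where [h] is the partial cosine sum: the means of
    [g h] and of [h^2] both equal the left-hand side. *)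
Lemma bessel (g : R -> R) (N : nat) :
  cont g -> zsum N (fun x => coef g x ^ 2) <= avg (fun p => g p ^ 2).
Proof.
intros hg.
set (h := fun p => zsum N (fun x => coef g x * cos (IZR x * p))).
assert (hh : cont h) by (apply cont_zsum; intros; apply cont_mult; [apply cont_const|apply cont_cos]).
assert (proj : forall f, cont f ->
  avg (fun p => f p * h p) = zsum N (fun x => coef g x * coef f x)).
{ intros f hf.
  rewrite (avg_ext _ (fun p => zsum N (fun x => coef g x * (cos (IZR x * p) * f p)))).
  - rewrite avg_zsum.
    + apply zsum_ext; intros x; apply avg_scal, cont_mult; [apply cont_cos|exact hf].
    + intros; apply cont_mult; [apply cont_const|apply cont_mult; [apply cont_cos|exact hf]].
  - intros p; unfold h; rewrite <- zsum_scal; apply zsum_ext; intros; ring. }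
assert (ch : forall y, (Z.abs y <= Z.of_nat N)%Z -> coef h y = coef g y).
{ intros y hy; unfold coef at 1; rewrite (proj _ (cont_cos (IZR y))).
  rewrite (zsum_ext N _ (fun x => / 2 * ((if Z.eq_dec x y then coef g x else 0)
     + (if Z.eq_dec x (- y) then coef g x else 0)))).
  (* The indices [y] and [- y] name the same cosine; each contributes half of [coef g y], also when
     they coincide at 0. *)
  - rewrite zsum_scal, zsum_plus, !zsum_delta by lia; rewrite coef_opp; field.
  - intros x; rewrite coef_cos; repeat destruct Z.eq_dec; ring. }
assert (E1 : avg (fun p => g p * h p) = zsum N (fun x => coef g x ^ 2)).
{ rewrite (proj g hg); apply zsum_ext; intros; ring. }
assert (E2 : avg (fun p => h p * h p) = zsum N (fun x => coef g x ^ 2)).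
{ rewrite (proj h hh); apply zsum_ext_in; intros x hx; rewrite (ch x hx); ring. }
assert (P : 0 <= avg (fun p => (g p + -1 * h p) ^ 2)).
{ rewrite <- (avg_const 0); apply avg_le; [apply cont_const| |intros; apply pow2_ge_0].
  contR. }
rewrite (avg_ext _ (fun p => g p ^ 2 + ((-2) * (g p * h p) + h p * h p))) in P by (intros; ring).
rewrite avg_plus, avg_plus, avg_scal, E1, E2 in P; contR.
lra.
Qed.

(** * Complex-valued cosine coefficients, taken componentwise *)

Definition contC (F : R -> C) : Prop := cont (fun p => Re (F p)) /\ cont (fun p => Im (F p)).

Definition ccoef (F : R -> C) (x : Z) : C :=
  (coef (fun p => Re (F p)) x, coef (fun p => Im (F p)) x).

Lemma ccoef_ext (F G : R -> C) (x : Z) : (forall p, F p = G p) -> ccoef F x = ccoef G x.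
Proof.
intros H; unfold ccoef; f_equal; apply coef_ext; intros; rewrite H; reflexivity.
Qed.

Lemma contC_plus (F G : R -> C) : contC F -> contC G -> contC (fun p => (F p + G p)%C).
Proof. intros [a b] [c d]; split; apply cont_plus; assumption. Qed.

Lemma contC_mult (F G : R -> C) : contC F -> contC G -> contC (fun p => (F p * G p)%C).
Proof.
intros [a b] [c d]; split.
- apply (cont_ext (fun p => Re (F p) * Re (G p) + (-1) * (Im (F p) * Im (G p)))).
  + intros; unfold Re, Im; simpl; ring.
  + contR.
- apply (cont_ext (fun p => Re (F p) * Im (G p) + Im (F p) * Re (G p))).
  + intros; unfold Re, Im; simpl; ring.
  + contR.
Qed.

Lemma contC_const (z : C) : contC (fun _ => z).
Proof. split; apply cont_const. Qed.

Lemma contC_RtoC (f : R -> R) : cont f -> contC (fun p => RtoC (f p)).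
Proof. intros h; split; [exact h|exact (cont_const 0)]. Qed.

Lemma cont_cos1 : cont cos.
Proof. intros p; apply continuous_cos. Qed.

Lemma coef_lin (f g : R -> R) (a b : R) (x : Z) :
  cont f -> cont g -> coef (fun p => a * f p + b * g p) x = a * coef f x + b * coef g x.
Proof.
intros hf hg; unfold coef; rewrite <- !avg_scal, <- avg_plus; contR.
apply avg_ext; intros; ring.
Qed.

Lemma ccoef_plus (F G : R -> C) (x : Z) :
  contC F -> contC G -> ccoef (fun p => (F p + G p)%C) x = (ccoef F x + ccoef G x)%C.
Proof.
intros [a b] [c d]; apply injective_projections; simpl.
- rewrite <- (Rmult_1_l (coef (fun p => Re (F p)) x)), <- (Rmult_1_l (coef (fun p => Re (G p)) x)).
  rewrite <- coef_lin by assumption.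
  apply avg_ext; intros; unfold Re; simpl; ring.
- rewrite <- (Rmult_1_l (coef (fun p => Im (F p)) x)), <- (Rmult_1_l (coef (fun p => Im (G p)) x)).
  rewrite <- coef_lin by assumption.
  apply avg_ext; intros; unfold Im; simpl; ring.
Qed.

Lemma ccoef_scal (z : C) (F : R -> C) (x : Z) :
  contC F -> ccoef (fun p => (z * F p)%C) x = (z * ccoef F x)%C.
Proof.
intros [a b]; apply injective_projections; simpl.
- replace (fst z * coef (fun p => Re (F p)) x - snd z * coef (fun p => Im (F p)) x)
    with (fst z * coef (fun p => Re (F p)) x + (- snd z) * coef (fun p => Im (F p)) x) by ring.
  rewrite <- coef_lin by assumption.
  apply avg_ext; intros; unfold Re, Im; simpl; ring.
- rewrite <- coef_lin by assumption.
  apply avg_ext; intros; unfold Re, Im; simpl; ring.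
Qed.

Lemma coef_neighbours (f : R -> R) (x : Z) :
  cont f -> coef f (x + 1) + coef f (x - 1) = coef (fun p => 2 * cos p * f p) x.
Proof.
intros hf; unfold coef; rewrite <- avg_plus; contR.
apply avg_ext; intros p; rewrite plus_IZR, minus_IZR.
replace ((IZR x + 1) * p) with (IZR x * p + p) by ring.
replace ((IZR x - 1) * p) with (IZR x * p - p) by ring.
rewrite cos_plus, cos_minus; ring.
Qed.

Lemma ccoef_neighbours (F : R -> C) (x : Z) :
  contC F ->
  (ccoef F (x + 1) + ccoef F (x - 1))%C = ccoef (fun p => (RtoC (2 * cos p) * F p)%C) x.
Proof.
intros [a b]; apply injective_projections; simpl; rewrite coef_neighbours by assumption;
  apply avg_ext; intros; unfold Re, Im; simpl; ring.
Qed.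

Lemma ccoef_one (x : Z) : ccoef (fun _ => 1%C) x = if Z.eq_dec x 0 then 1%C else 0%C.
Proof.
unfold ccoef, coef, Re, Im; simpl.
rewrite (avg_ext _ (fun p => cos (IZR x * p))), avg_cos by (intros; ring).
rewrite (avg_ext _ (fun p => 0)), avg_const by (intros; ring).
destruct Z.eq_dec; reflexivity.
Qed.

Lemma ccoef_bessel (F : R -> C) (B : R) (N : nat) :
  contC F -> (forall p, 0 <= p <= PI -> Cmod (F p) ^ 2 <= B) ->
  zsum N (fun x => Cmod (ccoef F x) ^ 2) <= B.
Proof.
intros [a b] HB.
rewrite (zsum_ext N _ (fun x => coef (fun p => Re (F p)) x ^ 2 + coef (fun p => Im (F p)) x ^ 2))
  by (intros; rewrite Cmod2_alt; reflexivity).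
rewrite zsum_plus.
apply Rle_trans with (avg (fun p => Re (F p) ^ 2 + Im (F p) ^ 2)).
- rewrite avg_plus by contR; generalize (bessel _ N a) (bessel _ N b); lra.
- rewrite <- (avg_const B); apply avg_le; [contR|contR|].
  intros p hp; rewrite <- Cmod2_alt; apply HB, hp.
Qed.

(** * The symbol *)

(* With [c = u + i v]: [sym_mod] is [|1 - c^2|], [sym_re] and [sym_im] are the real and
   imaginary parts of the principal root [s] of [1 - c^2], [sym_root] is [c - i s], and
   [sym_amp] is [i / (2 s)]. *)
Definition sym_mod (u v : R) : R :=
  sqrt (((1 - u) * (1 - u) + v * v) * ((1 + u) * (1 + u) + v * v)).
Definition sym_re (u v : R) : R := sqrt ((sym_mod u v + (1 - u * u + v * v)) * / 2).
Definition sym_im (u v : R) : R := - (u * v) * / sym_re u v.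
Definition sym_root (u v : R) : C := (u + sym_im u v, v - sym_re u v).
Definition sym_amp (u v : R) : C :=
  (sym_im u v * / (2 * sym_mod u v), sym_re u v * / (2 * sym_mod u v)).
Definition symbol (k : nat) (u v : R) : C := (Cpow (sym_root u v) k * sym_amp u v)%C.

(** On this set [1 - c^2] avoids the half-line of nonpositive reals, so its principal root is
    continuous. The first alternative serves [delta > 0], the second the neighbourhood of
    [delta = 0]. *)
Definition sym_dom (u v : R) : Prop := 0 < v \/ -1 < u < 1.

Lemma sym_mod_arg_pos (u v : R) : sym_dom u v ->
  0 < ((1 - u) * (1 - u) + v * v) * ((1 + u) * (1 + u) + v * v).
Proof.
intros h; generalize (Rle_0_sqr (1 - u)) (Rle_0_sqr (1 + u)) (Rle_0_sqr v); unfold Rsqr; intros.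
apply Rmult_lt_0_compat; destruct h as [h|h];
  [generalize (Rmult_lt_0_compat v v h h)|generalize (Rmult_lt_0_compat (1 - u) (1 - u))|
   generalize (Rmult_lt_0_compat v v h h)|generalize (Rmult_lt_0_compat (1 + u) (1 + u))]; lra.
Qed.

Lemma sym_mod_sqr (u v : R) : sym_dom u v ->
  sym_mod u v * sym_mod u v =
  (1 - u * u + v * v) * (1 - u * u + v * v) + 4 * (u * u) * (v * v).
Proof.
intros h; unfold sym_mod; rewrite sqrt_sqrt by (apply Rlt_le, sym_mod_arg_pos, h); ring.
Qed.

Lemma sym_mod_pos (u v : R) : sym_dom u v -> 0 < sym_mod u v.
Proof. intros h; apply sqrt_lt_R0, sym_mod_arg_pos, h. Qed.

(** If the real part of [1 - c^2] is not positive, then [v > 0] and [u^2 >= 1], so the imaginary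
    part is nonzero and the modulus strictly exceeds the absolute value of the real part. *)
Lemma sym_re_arg_pos (u v : R) : sym_dom u v ->
  0 < (sym_mod u v + (1 - u * u + v * v)) * / 2.
Proof.
intros h; generalize (sym_mod_sqr u v h) (sym_mod_pos u v h); intros hm hp.
enough (0 < sym_mod u v + (1 - u * u + v * v)) by lra.
destruct (Rlt_le_dec 0 (1 - u * u + v * v)) as [k|k]; [lra|].
assert (0 < v) by (destruct h; nra).
assert (0 < (u * u) * (v * v)) by (apply Rmult_lt_0_compat; nra).
nra.
Qed.

Lemma sym_re_pos (u v : R) : sym_dom u v -> 0 < sym_re u v.
Proof. intros h; apply sqrt_lt_R0, sym_re_arg_pos, h. Qed.

Lemma sym_re_im (u v : R) : sym_dom u v -> sym_re u v * sym_im u v = - (u * v).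
Proof. intros h; unfold sym_im; field; generalize (sym_re_pos u v h); lra. Qed.

Lemma sym_re_sqr (u v : R) : sym_dom u v ->
  sym_re u v * sym_re u v = (sym_mod u v + (1 - u * u + v * v)) / 2.
Proof. intros h; unfold sym_re; apply sqrt_sqrt, Rlt_le, sym_re_arg_pos, h. Qed.

Lemma sym_im_sqr (u v : R) : sym_dom u v ->
  sym_im u v * sym_im u v = (sym_mod u v - (1 - u * u + v * v)) / 2.
Proof.
intros h; generalize (sym_re_pos u v h) (sym_re_sqr u v h) (sym_re_im u v h) (sym_mod_sqr u v h).
intros hp hr hi hm.
apply Rmult_eq_reg_l with (sym_re u v * sym_re u v); [|nra].
transitivity ((sym_re u v * sym_im u v) * (sym_re u v * sym_im u v)); [ring|].
rewrite hi, hr; nra.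
Qed.

(** The characteristic equation: [(lam - c)^2 = - s^2 = c^2 - 1]. *)
Lemma sym_root_eq (u v : R) : sym_dom u v ->
  (sym_root u v * sym_root u v + 1 = 2 * (u, v) * sym_root u v)%C.
Proof.
intros h; generalize (sym_re_sqr u v h) (sym_re_im u v h) (sym_im_sqr u v h).
intros hr hi hm; apply injective_projections; simpl; nra.
Qed.

(** Here [lam - c = - i s], and its product with [i / (2 s)] is [1 / 2]. This fixes the amplitude:
    the two neighbours of time 0 together produce a unit source. *)
Lemma sym_amp_eq (u v : R) : sym_dom u v ->
  (2 * sym_root u v * sym_amp u v = 1 + 2 * (u, v) * sym_amp u v)%C.
Proof.
intros h; generalize (sym_re_sqr u v h) (sym_im_sqr u v h) (sym_mod_pos u v h).
unfold sym_root, sym_amp.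
generalize (sym_re u v) (sym_im u v) (sym_mod u v); intros s t M hr hi hM.
assert (hh : s * s + t * t = M) by lra.
apply injective_projections; simpl; [|field; lra].
rewrite <- hh; field; lra.
Qed.

Lemma symbol_0 (u v : R) : sym_dom u v ->
  (symbol 1 u v + symbol 1 u v = 1 + 2 * (u, v) * symbol 0 u v)%C.
Proof. intros h; unfold symbol; simpl; generalize (sym_amp_eq u v h); intros E;
transitivity (2 * sym_root u v * sym_amp u v)%C; [ring|rewrite E; ring]. Qed.

Lemma symbol_SS (k : nat) (u v : R) : sym_dom u v ->
  (symbol (S (S k)) u v + symbol k u v = 2 * (u, v) * symbol (S k) u v)%C.
Proof.
intros h; unfold symbol; cbn [Cpow].
transitivity ((sym_root u v * sym_root u v + 1) * (Cpow (sym_root u v) k * sym_amp u v))%C; [ring|].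
rewrite (sym_root_eq u v h); ring.
Qed.

(** The roots [c - i s] and [c + i s] have product [c^2 + s^2 = 1]. With [A] and [B] their squared
    moduli, [A * B = 1], so it suffices that [A < B]. *)
Lemma sym_root_lt1 (u v : R) : 0 < v -> Cmod (sym_root u v) ^ 2 < 1.
Proof.
intros hv; assert (h : sym_dom u v) by (left; exact hv).
rewrite Cmod2_alt; generalize (sym_re_sqr u v h) (sym_im_sqr u v h) (sym_re_im u v h)
  (sym_re_pos u v h); simpl.
generalize (sym_re u v) (sym_im u v) (sym_mod u v); intros s t M hs ht hst hp.
rewrite !Rmult_1_r.
set (A := (u + t) * (u + t) + (v - s) * (v - s)).
set (B := (u - t) * (u - t) + (v + s) * (v + s)).
assert (AB : A * B = 1).
{ assert (e1 : s * s - t * t = 1 - u * u + v * v) by lra.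
  transitivity ((u * u - v * v + (s * s - t * t)) * (u * u - v * v + (s * s - t * t))
    + 4 * ((u * v + s * t) * (u * v + s * t))); [unfold A, B; ring|].
  rewrite hst, e1; ring. }
assert (lt : A < B).
{ enough (0 < s * (B - A)).
  { apply Rmult_lt_reg_l with s; [exact hp|lra]. }
  replace (s * (B - A)) with (4 * (v * (s * s) - u * (s * t))) by (unfold A, B; ring).
  rewrite hst; generalize (Rmult_lt_0_compat _ _ hv (Rmult_lt_0_compat _ _ hp hp)).
  assert (0 <= u * u * v) by (apply Rmult_le_pos; [nra|lra]); lra. }
assert (0 <= A) by (unfold A; nra).
nra.
Qed.

(** * Continuity of the symbol in [u] and [v] *)

Lemma continuity_2d_sqrt (f : R -> R -> R) (x y : R) :
  0 < f x y -> continuity_2d_pt f x y -> continuity_2d_pt (fun u v => sqrt (f u v)) x y.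
Proof.
intros h hf; apply (continuity_1d_2d_pt_comp sqrt f); [|exact hf].
apply continuity_pt_sqrt; lra.
Qed.

Ltac cont2d := repeat (assumption || apply continuity_2d_pt_plus || apply continuity_2d_pt_minus ||
  apply continuity_2d_pt_mult || apply continuity_2d_pt_opp || apply continuity_2d_pt_id1 ||
  apply continuity_2d_pt_id2 || apply continuity_2d_pt_const).

Lemma sym_mod_cont (u v : R) : sym_dom u v -> continuity_2d_pt sym_mod u v.
Proof.
intros h; apply continuity_2d_sqrt; [apply sym_mod_arg_pos, h|cont2d].
Qed.

Lemma sym_re_cont (u v : R) : sym_dom u v -> continuity_2d_pt sym_re u v.
Proof.
intros h; apply continuity_2d_sqrt; [apply sym_re_arg_pos, h|].
generalize (sym_mod_cont u v h); intros; cont2d.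
Qed.

Lemma sym_im_cont (u v : R) : sym_dom u v -> continuity_2d_pt sym_im u v.
Proof.
intros h; unfold sym_im; cont2d.
apply continuity_2d_pt_inv; [apply sym_re_cont, h|generalize (sym_re_pos u v h); lra].
Qed.

Definition cont2C (F : R -> R -> C) (u v : R) : Prop :=
  continuity_2d_pt (fun u v => Re (F u v)) u v /\ continuity_2d_pt (fun u v => Im (F u v)) u v.

Lemma sym_amp_cont (u v : R) : sym_dom u v -> cont2C sym_amp u v.
Proof.
intros h; generalize (sym_re_cont u v h) (sym_im_cont u v h) (sym_mod_cont u v h); intros.
assert (continuity_2d_pt (fun u v => / (2 * sym_mod u v)) u v).
{ apply (continuity_2d_pt_inv (fun u v => 2 * sym_mod u v)); [cont2d|].
  generalize (sym_mod_pos u v h); lra. }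
split; unfold sym_amp, Re, Im; cbn [fst snd]; cont2d.
Qed.

Lemma symbol_cont (k : nat) (u v : R) : sym_dom u v -> cont2C (symbol k) u v.
Proof.
intros h; generalize (sym_re_cont u v h) (sym_im_cont u v h); intros.
induction k as [|k [IH1 IH2]].
- destruct (sym_amp_cont u v h) as [a b]; split;
  [apply (continuity_2d_pt_ext (fun u v => Re (sym_amp u v)))|
   apply (continuity_2d_pt_ext (fun u v => Im (sym_amp u v)))]; auto;
  intros; unfold symbol, Re, Im; simpl; ring.
- split.
  + apply (continuity_2d_pt_ext (fun u v => (u + sym_im u v) * Re (symbol k u v)
      - (v - sym_re u v) * Im (symbol k u v))); [|cont2d].
    intros; unfold symbol, Re, Im; simpl; ring.
  + apply (continuity_2d_pt_ext (fun u v => (u + sym_im u v) * Im (symbol k u v)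
      + (v - sym_re u v) * Re (symbol k u v))); [|cont2d].
    intros; unfold symbol, Re, Im; simpl; ring.
Qed.

Lemma continuity_2d_comp1 (f : R -> R -> R) (g : R -> R) (v p : R) :
  continuity_2d_pt f (g p) v -> continuous g p -> continuous (fun p => f (g p) v) p.
Proof.
intros hf hg; apply (continuous_comp_2 (V := R_UniformSpace) (W := R_UniformSpace) g (fun _ => v) f p);
  [exact hg|apply continuous_const|].
apply continuity_2d_pt_filterlim, hf.
Qed.

Lemma cont_rcos (r : R) : cont (fun p => r * cos p).
Proof. apply (cont_mult (fun _ => r) cos); [apply cont_const|apply cont_cos1]. Qed.

Lemma symbol_contC (k : nat) (r v : R) :
  (forall p, sym_dom (r * cos p) v) -> contC (fun p => symbol k (r * cos p) v).
Proof.
intros h; split; intros p; destruct (symbol_cont k _ _ (h p)) as [a b].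
- apply (continuity_2d_comp1 (fun u v => Re (symbol k u v)) (fun p => r * cos p)); [exact a|apply cont_rcos].
- apply (continuity_2d_comp1 (fun u v => Im (symbol k u v)) (fun p => r * cos p)); [exact b|apply cont_rcos].
Qed.

(** * The fundamental solution *)

Definition green (r v : R) (x t : Z) : C :=
  ccoef (fun p => symbol (Z.abs_nat t) (r * cos p) v) x.

Section Green.
Variables (r v : R) (hdom : forall p, sym_dom (r * cos p) v).

(** Used with [z = 1] at time 0 and [z = 0] elsewhere. Naming the three absolute values [k0], [k1],
    [k2] lets one statement cover positive, zero and negative times. *)
Lemma green_time_eq (x t : Z) (k0 k1 k2 : nat) (z : C) :
  Z.abs_nat t = k0 -> Z.abs_nat (t + 1) = k1 -> Z.abs_nat (t - 1) = k2 ->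
  (forall p, (symbol k1 (r * cos p) v + symbol k2 (r * cos p) v =
     z * 1 + 2 * ((r * cos p)%R, v) * symbol k0 (r * cos p) v)%C) ->
  scalar_op r (2 * v) (green r v) x t = (z * if Z.eq_dec x 0 then 1%C else 0%C)%C.
Proof.
intros h0 h1 h2 H; unfold scalar_op, green; rewrite h0, h1, h2.
generalize (fun k => symbol_contC k r v hdom); intros hc.
rewrite <- ccoef_plus, (ccoef_neighbours (fun p => symbol k0 (r * cos p) v)), <- (ccoef_one x),
  <- (ccoef_scal z (fun _ => 1%C)) by (auto using contC_const).
rewrite (ccoef_ext _ _ x H).
assert (hcos : contC (fun p => RtoC (2 * cos p))).
{ apply contC_RtoC, (cont_mult (fun _ => 2) cos); [apply cont_const|apply cont_cos1]. }
rewrite (ccoef_ext (fun p => z * 1 + 2 * ((r * cos p)%R, v) * symbol k0 (r * cos p) v)%C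
  (fun p => z * 1 + (RtoC r * (RtoC (2 * cos p) * symbol k0 (r * cos p) v)
     + Ci * RtoC (2 * v) * symbol k0 (r * cos p) v))%C).
- rewrite !ccoef_plus, !ccoef_scal; auto 10 using contC_const, contC_plus, contC_mult.
  ring.
- intros p.
  replace (((r * cos p)%R, v) : C) with (RtoC r * RtoC (cos p) + Ci * RtoC v)%C
    by (apply injective_projections; simpl; ring).
  rewrite !RtoC_mult; ring.
Qed.

Lemma green_eq (x t : Z) : scalar_op r (2 * v) (green r v) x t = point_src x t.
Proof.
destruct (Z.eq_dec t 0) as [->|ht].
- rewrite (green_time_eq x 0 0 1 1 1%C); try reflexivity.
  + unfold point_src; destruct Z.eq_dec; simpl; ring.
  + intros p; rewrite (symbol_0 _ _ (hdom p)); ring.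
- assert (E : point_src x t = (0 * if Z.eq_dec x 0 then 1%C else 0%C)%C).
  { unfold point_src; destruct (Z.eq_dec x 0), (Z.eq_dec t 0); try lia; ring. }
  rewrite E; destruct (Z_lt_le_dec 0 t) as [k|k].
  + apply (green_time_eq x t (S (Z.abs_nat (t - 1))) (S (S (Z.abs_nat (t - 1)))) (Z.abs_nat (t - 1)));
      try lia.
    intros p; rewrite (symbol_SS _ _ _ (hdom p)); ring.
  + apply (green_time_eq x t (S (Z.abs_nat (t + 1))) (Z.abs_nat (t + 1)) (S (S (Z.abs_nat (t + 1)))));
      try lia.
    intros p; rewrite Cplus_comm, (symbol_SS _ _ _ (hdom p)); ring.
Qed.

Lemma green_even_x (x t : Z) : green r v (- x) t = green r v x t.
Proof. unfold green, ccoef; rewrite !coef_opp; reflexivity. Qed.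

Lemma green_even_t (x t : Z) : green r v x (- t) = green r v x t.
Proof. unfold green; replace (Z.abs_nat (- t)) with (Z.abs_nat t) by lia; reflexivity. Qed.

End Green.

Lemma Cmod_Cpow (z : C) (k : nat) : Cmod (Cpow z k) = Cmod z ^ k.
Proof. induction k as [|k IH]; simpl; [apply Cmod_1|rewrite Cmod_mult, IH; reflexivity]. Qed.

Lemma zsum_geom (q : R) (N : nat) : 0 <= q < 1 ->
  zsum N (fun t => q ^ Z.abs_nat t) <= 2 / (1 - q).
Proof.
intros hq.
assert (E : (1 - q) * zsum N (fun t => q ^ Z.abs_nat t) = (1 - q) + 2 * (q - q ^ (S N))).
{ induction N as [|N IH]; [rewrite zsum_O; simpl; ring|].
  rewrite zsum_S; replace (Z.abs_nat (- Z.of_nat (S N))) with (S N) by lia.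
  rewrite Zabs2Nat.id, !Rmult_plus_distr_l, IH; simpl; ring. }
assert (0 <= q ^ S N) by (apply pow_le; lra).
apply Rmult_le_reg_l with (1 - q); [lra|].
rewrite E; replace ((1 - q) * (2 / (1 - q))) with 2 by (field; lra); lra.
Qed.

Lemma cont_max (g : R -> R) : cont g ->
  exists p0, forall p, 0 <= p <= PI -> g p <= g p0.
Proof.
intros h; destruct (continuity_ab_maj g 0 PI) as [p0 [H _]].
- generalize PI_RGT_0; lra.
- intros; apply continuity_pt_filterlim, h.
- exists p0; exact H.
Qed.

(** Bessel's inequality at each time [t] gives a bound [B q^|t|], and the geometric series sums
    these over [t]. *)
Lemma green_l2 (r v : R) : 0 < v ->
  exists M, forall N, sum_box N (fun x t => Cmod (green r v x t) ^ 2) <= M.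
Proof.
intros hv.
assert (hdom : forall p, sym_dom (r * cos p) v) by (left; exact hv).
assert (sqr : forall F, contC F -> cont (fun p => Cmod (F p) ^ 2)).
{ intros F [a b]; apply (cont_ext (fun p => Re (F p) ^ 2 + Im (F p) ^ 2)); [|contR].
  intros; rewrite Cmod2_alt; reflexivity. }
assert (croot : contC (fun p => sym_root (r * cos p) v)).
{ split; intros p; generalize (sym_re_cont _ _ (hdom p)) (sym_im_cont _ _ (hdom p)); intros.
  - apply (continuity_2d_comp1 (fun u v => u + sym_im u v) (fun p => r * cos p)); [cont2d|apply cont_rcos].
  - apply (continuity_2d_comp1 (fun u v => v - sym_re u v) (fun p => r * cos p)); [cont2d|apply cont_rcos]. }
(* The maximum over the compact [[0, PI]] is attained, so the pointwise bound [|lam| < 1] becomes a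
   uniform ratio [q < 1]. *)
destruct (cont_max _ (sqr _ croot)) as [p0 H0].
destruct (cont_max _ (sqr _ (symbol_contC 0 r v hdom))) as [p1 H1].
set (q := Cmod (sym_root (r * cos p0) v) ^ 2) in *.
set (B := Cmod (symbol 0 (r * cos p1) v) ^ 2) in *.
assert (hq : 0 <= q < 1) by (split; [apply pow2_ge_0|apply sym_root_lt1, hv]).
assert (hB : 0 <= B) by apply pow2_ge_0.
exists (B * (2 / (1 - q))); intros N.
rewrite sum_box_swap, sum_box_zsum.
apply Rle_trans with (zsum N (fun t => B * q ^ Z.abs_nat t)).
- apply zsum_le; intros t; apply ccoef_bessel; [apply symbol_contC, hdom|].
  intros p hp; unfold symbol; rewrite Cmod_mult, Cmod_Cpow, Rpow_mult_distr, <- pow_mult,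
    Nat.mul_comm, pow_mult, Rmult_comm.
  apply Rmult_le_compat; [apply pow2_ge_0|apply pow_le, pow2_ge_0| |].
  + generalize (H1 p hp); unfold symbol; simpl Cpow; rewrite Cmult_1_l; exact (fun H => H).
  + apply pow_incr; split; [apply pow2_ge_0|apply H0, hp].
- rewrite zsum_scal; apply Rmult_le_compat_l; [exact hB|apply zsum_geom, hq].
Qed.

(** * Existence *)

Definition l2 (u : Z -> Z -> C) : Prop :=
  exists M, forall N, sum_box N (fun x t => Cmod (u x t) ^ 2) <= M.

Lemma l2_plus (u w : Z -> Z -> C) : l2 u -> l2 w -> l2 (fun x t => (u x t + w x t)%C).
Proof.
intros [M HM] [M' HM']; exists (2 * (M + M')); intros N.
apply Rle_trans with (sum_box N (fun x t => 2 * (Cmod (u x t) ^ 2 + Cmod (w x t) ^ 2))).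
- apply sum_box_le; intros x t.
  generalize (Cmod_minus_sqr (u x t) (- w x t)); rewrite Cmod_opp.
  replace (u x t - - w x t)%C with (u x t + w x t)%C by ring; exact (fun H => H).
- rewrite sum_box_scal, sum_box_plus; generalize (HM N) (HM' N); lra.
Qed.

Lemma l2_scal (z : C) (u : Z -> Z -> C) : l2 u -> l2 (fun x t => (z * u x t)%C).
Proof.
intros [M HM]; exists (Cmod z ^ 2 * M); intros N.
rewrite (sum_box_ext N _ (fun x t => Cmod z ^ 2 * Cmod (u x t) ^ 2))
  by (intros; rewrite Cmod_mult; ring).
rewrite sum_box_scal; apply Rmult_le_compat_l; [apply pow2_ge_0|apply HM].
Qed.

Lemma sum_box_shift (N : nat) (f : Z -> Z -> R) : (forall x t, 0 <= f x t) ->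
  sum_box N (fun x t => f (x + 1)%Z t) <= sum_box (S N) f.
Proof.
intros H; rewrite !sum_box_zsum.
apply Rle_trans with (zsum (S N) (fun x => zsum N (fun t => f x t))).
- apply (zsum_shift N (fun x => zsum N (fun t => f x t))).
  intros; apply zsum_nonneg; intros; apply H.
- apply zsum_le; intros; apply zsum_leS; intros; apply H.
Qed.

Lemma l2_shift_x (u : Z -> Z -> C) : l2 u -> l2 (fun x t => u (x + 1)%Z t).
Proof.
intros [M HM]; exists M; intros N; eapply Rle_trans; [|apply (HM (S N))].
apply (sum_box_shift N (fun x t => Cmod (u x t) ^ 2)); intros; apply pow2_ge_0.
Qed.

Lemma l2_shift_t (u : Z -> Z -> C) : l2 u -> l2 (fun x t => u x (t + 1)%Z).
Proof.
intros [M HM]; exists M; intros N; eapply Rle_trans; [|apply (HM (S N))].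
rewrite sum_box_swap, (sum_box_swap (S N)).
apply (sum_box_shift N (fun t x => Cmod (u x t) ^ 2)); intros; apply pow2_ge_0.
Qed.

Lemma l2_ext (u w : Z -> Z -> C) : (forall x t, u x t = w x t) -> l2 u -> l2 w.
Proof.
intros H [M HM]; exists M; intros N; rewrite (sum_box_ext N _ (fun x t => Cmod (u x t) ^ 2));
  [apply HM|intros; rewrite H; reflexivity].
Qed.

Lemma kernel_l2 (r mu d : R) (K : Z -> Z -> C) :
  l2 K -> l2 (kernel_a r mu d K) /\ l2 (kernel_b r mu d K).
Proof.
intros h; split.
- apply (l2_ext (fun x t => 2 * RtoC r * RtoC mu * K x t + (- (2 * RtoC r * Ci * RtoC d)) * K (x + 1)%Z t)%C).
  + intros; unfold kernel_a; ring.
  + auto using l2_plus, l2_scal, l2_shift_x.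
- apply (l2_ext (fun x t => 2 * K x (t + 1)%Z + ((- (2 * RtoC r)) * K (x + 1)%Z t
    + (- (2 * RtoC r * Ci * RtoC mu * RtoC d)) * K x t))%C).
  + intros; unfold kernel_b; ring.
  + auto 6 using l2_plus, l2_scal, l2_shift_x, l2_shift_t.
Qed.

Definition coupling (eps m d : R) : R := 1 / sqrt (1 + m ^ 2 * eps ^ 2) * (1 / sqrt (1 - d ^ 2)).

Definition solution_kernel (eps m d : R) : Z -> Z -> C :=
  green (coupling eps m d) (coupling eps m d * (m * eps) * d).

Definition solution_a (eps m d : R) : Z -> Z -> C :=
  kernel_a (coupling eps m d) (m * eps) d (solution_kernel eps m d).

Definition solution_b (eps m d : R) : Z -> Z -> C :=
  kernel_b (coupling eps m d) (m * eps) d (solution_kernel eps m d).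

Section Existence.
Variables (eps m d : R) (heps : 0 < eps) (hm : 0 < m) (hd : 0 < d < 1).

Lemma solution_axioms :
  axioms eps m d (extend_a eps d (solution_a eps m d) (solution_b eps m d))
                 (extend_b eps d (solution_a eps m d) (solution_b eps m d)).
Proof.
assert (hr : 0 < coupling eps m d) by (apply amplitude_coef_pos, hd).
assert (hv : 0 < coupling eps m d * (m * eps) * d).
{ apply Rmult_lt_0_compat; [|lra]; apply Rmult_lt_0_compat; [exact hr|].
  apply Rmult_lt_0_compat; assumption. }
destruct (kernel_l2 (coupling eps m d) (m * eps) d _ (green_l2 (coupling eps m d) _ hv))
  as [[Ma HMa] [Mb HMb]].
apply (extend_axioms eps m d heps _ _ (Ma + Mb)).
- apply kernel_step; [apply amplitude_coef, hd|].
  intros x t; unfold solution_kernel.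
  rewrite <- (green_eq (coupling eps m d) _ (fun p => or_introl hv)).
  f_equal; ring.
- intros N; rewrite sum_box_plus; generalize (HMa N) (HMb N).
  unfold solution_a, solution_b, solution_kernel; lra.
Qed.

(** This lets the limit of an arbitrary family of solutions be read off the explicit one. *)
Lemma solution_unique (A B : R -> R -> C) : axioms eps m d A B ->
  forall x t, on_lattice eps A x t = solution_a eps m d x t /\
              on_lattice eps B x t = solution_b eps m d x t.
Proof.
intros HA x t.
destruct (axioms_lattice_unique eps m d heps hd A B _ _ hm HA solution_axioms x t) as [-> ->].
unfold on_lattice; rewrite <- !(hc_double eps).
apply extend_even, heps.
Qed.

End Existence.

(** * The limit *)

Lemma clim_iff (T : Type) (F : (T -> Prop) -> Prop) (FF : Filter F) (f : T -> C) (L : C) :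
  filterlim f F (locally L) <->
  (filterlim (fun d => Re (f d)) F (locally (Re L)) /\
   filterlim (fun d => Im (f d)) F (locally (Im L))).
Proof.
split.
- intros H; split; apply filterlim_locally; intros e;
  generalize (proj1 (filterlim_locally f L) H e); apply filter_imp; intros d [h1 h2]; assumption.
- intros [H1 H2]; apply filterlim_locally; intros e.
  generalize (filter_and _ _ (proj1 (filterlim_locally _ _) H1 e) (proj1 (filterlim_locally _ _) H2 e)).
  apply filter_imp; intros d h; exact h.
Qed.

Section Limits.
Context {T : Type} {F : (T -> Prop) -> Prop} {FF : Filter F}.

Lemma rlim_plus (f g : T -> R) (a b : R) :
  filterlim f F (locally a) -> filterlim g F (locally b) ->
  filterlim (fun d => f d + g d) F (locally (a + b)).
Proof.
intros hf hg.
exact (filterlim_comp_2 f g plus hf hg (filterlim_plus (V := R_NormedModule) a b)).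
Qed.

Lemma rlim_mult (f g : T -> R) (a b : R) :
  filterlim f F (locally a) -> filterlim g F (locally b) ->
  filterlim (fun d => f d * g d) F (locally (a * b)).
Proof.
intros hf hg.
exact (filterlim_comp_2 f g mult hf hg (filterlim_mult (K := R_AbsRing) a b)).
Qed.

Lemma clim_plus (f g : T -> C) (a b : C) :
  filterlim f F (locally a) -> filterlim g F (locally b) ->
  filterlim (fun d => (f d + g d)%C) F (locally (a + b)%C).
Proof.
rewrite !clim_iff by exact FF; intros [h1 h2] [k1 k2]; split; apply rlim_plus; assumption.
Qed.

Lemma clim_mult (f g : T -> C) (a b : C) :
  filterlim f F (locally a) -> filterlim g F (locally b) ->
  filterlim (fun d => (f d * g d)%C) F (locally (a * b)%C).
Proof.
rewrite !clim_iff by exact FF; intros [h1 h2] [k1 k2]; split.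
- replace (Re (a * b)%C) with (Re a * Re b + -1 * (Im a * Im b)) by (unfold Re, Im; simpl; ring).
  apply (filterlim_ext (fun d => Re (f d) * Re (g d) + -1 * (Im (f d) * Im (g d)))).
  + intros; unfold Re, Im; simpl; ring.
  + apply rlim_plus; [apply rlim_mult; assumption|].
    apply rlim_mult; [apply filterlim_const|apply rlim_mult; assumption].
- apply rlim_plus; apply rlim_mult; assumption.
Qed.

Lemma clim_RtoC (f : T -> R) (a : R) :
  filterlim f F (locally a) -> filterlim (fun d => RtoC (f d)) F (locally (RtoC a)).
Proof. intros h; apply clim_iff; [exact FF|]; split; [exact h|apply (filterlim_const (U := R_UniformSpace) 0)]. Qed.

Lemma coef_close (f g : R -> R) (x : Z) (e : R) :
  cont f -> cont g -> (forall p, Rabs (f p - g p) <= e) ->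
  Rabs (coef f x - coef g x) <= e.
Proof.
intros hf hg H.
replace (coef f x - coef g x) with (1 * coef f x + -1 * coef g x) by ring.
rewrite <- coef_lin by assumption; unfold coef.
assert (hc : cont (fun p => cos (IZR x * p) * (1 * f p + -1 * g p))).
{ contR. }
assert (B : forall p, - e <= cos (IZR x * p) * (1 * f p + -1 * g p) <= e).
{ intros p; apply Rabs_le_between; rewrite Rabs_mult, <- (Rmult_1_l e).
  apply Rmult_le_compat; try apply Rabs_pos.
  - apply Rabs_le, COS_bound.
  - replace (1 * f p + -1 * g p) with (f p - g p) by ring; apply H. }
apply Rabs_le; split.
- rewrite <- (avg_const (- e)); apply avg_le; [apply cont_const|exact hc|intros; apply B].
- rewrite <- (avg_const e); apply avg_le; [exact hc|apply cont_const|intros; apply B].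
Qed.

Lemma sym_dom_rcos (r v : R) : 0 <= r < 1 -> forall p, sym_dom (r * cos p) v.
Proof. intros hr p; right; generalize (COS_bound p); nra. Qed.

(** For [r] near [n < 1] the argument [r cos p] stays in a compact subinterval of [(-1, 1)], so
    uniform continuity of [f] gives convergence uniform in [p], hence convergence of the
    averages. *)
Lemma coef_limit (f : R -> R -> R) (r v : T -> R) (n : R) (x : Z) :
  0 <= n < 1 ->
  (forall u v, -1 < u < 1 -> continuity_2d_pt f u v) ->
  filterlim r F (locally n) -> filterlim v F (locally 0) ->
  F (fun d => 0 <= r d /\ 0 <= v d) ->
  filterlim (fun d => coef (fun p => f (r d * cos p) (v d)) x) F
    (locally (coef (fun p => f (n * cos p) 0) x)).
Proof.
intros hn hf hr hv hp; apply filterlim_locally; intros e.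
set (u0 := (1 + n) / 2).
destruct (uniform_continuity_2d f (- u0) u0 0 1) with (eps := pos_div_2 e) as [del Hdel].
{ intros; apply hf; unfold u0 in *; lra. }
(* The three bounds serve uniform continuity, [v < 1] and [r < u0] in turn; [(1 - n) / 2] is the
   distance from [n] to the midpoint [u0]. *)
assert (hdel : 0 < Rmin del (Rmin 1 ((1 - n) / 2))).
{ repeat apply Rmin_glb_lt; [apply cond_pos|lra|lra]. }
generalize (filter_and _ _ hp (filter_and _ _
  (proj1 (filterlim_locally _ _) hr (mkposreal _ hdel)) (proj1 (filterlim_locally _ _) hv (mkposreal _ hdel)))).
apply filter_imp; intros d [[hr0 hv0] [hr1 hv1]].
change (Rabs (r d - n) < Rmin del (Rmin 1 ((1 - n) / 2))) in hr1.
change (Rabs (v d - 0) < Rmin del (Rmin 1 ((1 - n) / 2))) in hv1.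
change (Rabs (coef (fun p => f (r d * cos p) (v d)) x - coef (fun p => f (n * cos p) 0) x) < e).
assert (m1 := Rmin_l del (Rmin 1 ((1 - n) / 2))).
assert (m2 := Rle_trans _ _ _ (Rmin_r del (Rmin 1 ((1 - n) / 2))) (Rmin_l _ _)).
assert (m3 := Rle_trans _ _ _ (Rmin_r del (Rmin 1 ((1 - n) / 2))) (Rmin_r _ _)).
assert (hrd : Rabs (r d - n) < del) by lra.
assert (hvd : Rabs (v d - 0) < del) by lra.
assert (hr2 : r d < u0).
{ unfold u0; assert (k : Rabs (r d - n) < (1 - n) / 2) by lra.
  apply Rabs_lt_between in k; lra. }
assert (hv2 : v d < 1).
{ assert (k : Rabs (v d - 0) < 1) by lra; apply Rabs_lt_between in k; lra. }
apply Rle_lt_trans with (e / 2); [|generalize (cond_pos e); lra].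
assert (hC : forall s w, 0 <= s <= u0 -> cont (fun p => f (s * cos p) w)).
{ intros s w hs p; apply (continuity_2d_comp1 f (fun p => s * cos p)); [|apply cont_rcos].
  apply hf; unfold u0 in hs; generalize (COS_bound p); nra. }
apply coef_close; [apply hC; lra|apply hC; unfold u0; lra|].
intros p; generalize (COS_bound p); intros hcp; apply Rlt_le, Hdel;
  try (unfold u0 in *; nra); try exact hvd.
replace (r d * cos p - n * cos p) with (cos p * (r d - n)) by ring.
rewrite Rabs_mult; apply Rle_lt_trans with (1 * Rabs (r d - n)); [|lra].
apply Rmult_le_compat_r; [apply Rabs_pos|apply Rabs_le; exact hcp].
Qed.

Lemma green_limit (r v : T -> R) (n : R) (x t : Z) :
  0 <= n < 1 ->
  filterlim r F (locally n) -> filterlim v F (locally 0) ->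
  F (fun d => 0 <= r d /\ 0 <= v d) ->
  filterlim (fun d => green (r d) (v d) x t) F (locally (green n 0 x t)).
Proof.
intros hn hr hv hp; apply clim_iff; [exact FF|]; split.
- apply (coef_limit (fun u v => Re (symbol (Z.abs_nat t) u v))); try assumption.
  intros u w h; apply symbol_cont; right; exact h.
- apply (coef_limit (fun u v => Im (symbol (Z.abs_nat t) u v))); try assumption.
  intros u w h; apply symbol_cont; right; exact h.
Qed.

Lemma kernel_limit (r mu d : T -> R) (r0 mu0 d0 : R) (K : T -> Z -> Z -> C) (K0 : Z -> Z -> C) :
  filterlim r F (locally r0) -> filterlim mu F (locally mu0) -> filterlim d F (locally d0) ->
  (forall x t, filterlim (fun s => K s x t) F (locally (K0 x t))) ->
  forall x t,
    filterlim (fun s => kernel_a (r s) (mu s) (d s) (K s) x t) F (locally (kernel_a r0 mu0 d0 K0 x t)) /\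
    filterlim (fun s => kernel_b (r s) (mu s) (d s) (K s) x t) F (locally (kernel_b r0 mu0 d0 K0 x t)).
Proof.
intros hr hmu hd hK x t; unfold kernel_a, kernel_b, Cminus.
assert (opp : forall (f : T -> C) a, filterlim f F (locally a) ->
  filterlim (fun s => (- f s)%C) F (locally (- a)%C)).
{ intros f a h; replace (- a)%C with (RtoC (-1) * a)%C by ring.
  apply (filterlim_ext (fun s => (RtoC (-1) * f s)%C)); [intros; ring|].
  apply clim_mult; [apply filterlim_const|exact h]. }
split; repeat lazymatch goal with
| |- filterlim (fun s => Cplus _ _) _ _ => apply clim_plus
| |- filterlim (fun s => Cmult _ _) _ _ => apply clim_mult
| |- filterlim (fun s => Copp _) _ _ => apply opp
| |- filterlim (fun s => K s _ _) _ _ => apply hK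
| |- filterlim (fun s => RtoC (r s)) _ _ => apply clim_RtoC, hr
| |- filterlim (fun s => RtoC (mu s)) _ _ => apply clim_RtoC, hmu
| |- filterlim (fun s => RtoC (d s)) _ _ => apply clim_RtoC, hd
| |- filterlim _ _ _ => apply filterlim_const
end.
Qed.

End Limits.

Lemma coupling_lim (eps m : R) :
  filterlim (coupling eps m) (at_right 0) (locally (coupling eps m 0)).
Proof.
assert (H : filterlim (coupling eps m) (locally 0) (locally (coupling eps m 0))).
{ apply continuity_pt_filterlim; unfold coupling.
  apply derivable_continuous_pt, ex_derive_Reals_0; auto_derive.
  replace (1 + - (0 * (0 * 1))) with 1 by ring; rewrite sqrt_1; repeat split; lra. }
intros P HP; apply filter_le_within, H, HP.
Qed.

Lemma coupling_0 (eps m : R) : coupling eps m 0 = 1 / sqrt (1 + m ^ 2 * eps ^ 2).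
Proof. unfold coupling; replace (1 - 0 ^ 2) with 1 by ring; rewrite sqrt_1; field.
apply Rgt_not_eq, sqrt_lt_R0; assert (0 <= m ^ 2 * eps ^ 2) by (apply Rmult_le_pos; apply pow2_ge_0); lra.
Qed.

Lemma coupling_0_lt1 (eps m : R) : 0 < eps -> 0 < m -> 0 <= coupling eps m 0 < 1.
Proof.
intros he hm; rewrite coupling_0.
assert (0 < m ^ 2 * eps ^ 2) by (apply Rmult_lt_0_compat; apply pow_lt; assumption).
assert (h : 1 < sqrt (1 + m ^ 2 * eps ^ 2)) by (rewrite <- sqrt_1 at 1; apply sqrt_lt_1; lra).
split; [apply Rlt_le, Rdiv_lt_0_compat; lra|].
apply Rmult_lt_reg_r with (sqrt (1 + m ^ 2 * eps ^ 2)); [lra|].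
unfold Rdiv; rewrite Rmult_assoc, Rinv_l; lra.
Qed.

Lemma solution_limit (eps m : R) (x t : Z) : 0 < eps -> 0 < m ->
  let n := coupling eps m 0 in
  filterlim (fun d => solution_a eps m d x t) (at_right 0) (locally (kernel_a n (m * eps) 0 (green n 0) x t)) /\
  filterlim (fun d => solution_b eps m d x t) (at_right 0) (locally (kernel_b n (m * eps) 0 (green n 0) x t)).
Proof.
intros he hm n.
assert (hd : filterlim (fun d : R => d) (at_right 0) (locally 0)).
{ intros P; apply filter_le_within. }
apply (kernel_limit (coupling eps m) (fun _ => m * eps) (fun d => d) n (m * eps) 0 (solution_kernel eps m)).
- apply coupling_lim.
- apply filterlim_const.
- exact hd.
- intros y s; apply (green_limit (coupling eps m) (fun d => coupling eps m d * (m * eps) * d)).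
  + apply coupling_0_lt1; assumption.
  + apply coupling_lim.
  + replace 0 with (n * (m * eps) * 0) at 2 by ring.
    apply rlim_mult; [apply rlim_mult; [apply coupling_lim|apply filterlim_const]|exact hd].
  + exists (mkposreal 1 Rlt_0_1); intros d hb hd0.
    change (Rabs (d - 0) < 1) in hb; apply Rabs_lt_between in hb.
    assert (hr : 0 < coupling eps m d) by (apply amplitude_coef_pos; lra).
    split; [lra|].
    apply Rmult_le_pos; [apply Rmult_le_pos|lra]; [lra|apply Rmult_le_pos; lra].
Qed.

(** * Parity of the limit kernel *)

Lemma sym_re_opp (u : R) : sym_re (- u) 0 = sym_re u 0.
Proof.
unfold sym_re, sym_mod; f_equal; f_equal; f_equal; [f_equal|]; ring.
Qed.

Lemma sym_im_0 (u : R) : sym_im u 0 = 0.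
Proof. unfold sym_im; ring. Qed.

(** For [v = 0], changing the sign of [u] sends [lam] to minus its conjugate and fixes the purely
    imaginary amplitude, which is also minus its conjugate. *)
Lemma symbol_opp (k : nat) (u : R) :
  symbol k (- u) 0 = (RtoC ((-1) ^ k) * ((- Re (symbol k u 0))%R, Im (symbol k u 0)))%C.
Proof.
induction k as [|k IH].
- unfold symbol, sym_amp; rewrite !sym_im_0, sym_re_opp.
  replace (sym_mod (- u) 0) with (sym_mod u 0) by (unfold sym_mod; f_equal; ring).
  apply injective_projections; simpl; ring.
- assert (E : forall w, symbol (S k) w 0 = (sym_root w 0 * symbol k w 0)%C)
    by (intros; unfold symbol; simpl; ring).
  rewrite !E, IH; unfold sym_root; rewrite !sym_im_0, sym_re_opp.
  apply injective_projections; unfold Re, Im; simpl; ring.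
Qed.

Lemma coef_reflect (f : R -> R) (x : Z) : cont f ->
  coef (fun p => f (PI - p)) x = cos (IZR x * PI) * coef f x.
Proof.
intros hf; unfold coef.
assert (hr : forall g, cont g -> cont (fun p => g (PI - p))).
{ intros g hg p; apply (continuous_comp (fun p => PI - p) g); [|apply hg].
  apply (continuous_minus (fun _ => PI) (fun p => p)); [apply continuous_const|apply continuous_id]. }
assert (sub : forall g, cont g -> avg (fun p => g (PI - p)) = avg g).
{ intros g hg; unfold avg; f_equal.
  generalize (RInt_comp_lin (V := R_CompleteNormedModule) g (-1) PI PI 0).
  replace (-1 * PI + PI) with 0 by ring; replace (-1 * 0 + PI) with PI by ring.
  intros H; rewrite <- H by (apply cont_integrable, hg).
  rewrite <- (opp_RInt_swap (V := R_CompleteNormedModule)).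
  - rewrite <- (RInt_opp (V := R_CompleteNormedModule)).
    + apply RInt_ext; intros p _; unfold opp, scal; simpl; unfold mult; simpl.
      replace (-1 * p + PI) with (PI - p) by ring; ring.
    + apply ex_RInt_swap, cont_integrable, hr, hg.
  - apply ex_RInt_swap, cont_integrable, hr, hg. }
rewrite <- avg_scal by (apply cont_mult; [apply cont_cos|exact hf]).
rewrite <- (sub (fun p => cos (IZR x * PI) * (cos (IZR x * p) * f p))).
- apply avg_ext; intros p; rewrite <- Rmult_assoc; f_equal.
  replace (IZR x * (PI - p)) with (IZR x * PI - IZR x * p) by ring.
  assert (s0 : sin (IZR x * PI) = 0) by (apply sin_eq_0_1; exists x; reflexivity).
  rewrite cos_minus, s0; generalize (sin2_cos2 (IZR x * PI)); rewrite s0; unfold Rsqr; intros h.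
  transitivity ((cos (IZR x * PI) * cos (IZR x * PI)) * cos (IZR x * p)); [|ring].
  replace (cos (IZR x * PI) * cos (IZR x * PI)) with 1 by lra; ring.
- apply cont_mult; [apply cont_const|apply cont_mult; [apply cont_cos|exact hf]].
Qed.

Lemma cos_even_PI (x : Z) : Z.Even x -> cos (IZR x * PI) = 1.
Proof.
intros [k ->]; rewrite mult_IZR, Rmult_assoc, cos_2a_sin, sin_eq_0_1 by (exists k; reflexivity); ring.
Qed.

Lemma cos_odd_PI (x : Z) : Z.Odd x -> cos (IZR x * PI) = -1.
Proof.
intros [k ->]; rewrite plus_IZR, Rmult_plus_distr_r, Rmult_1_l, neg_cos, cos_even_PI;
  [reflexivity|exists k; reflexivity].
Qed.

Lemma pow_opp1_even (k : nat) : Z.Even (Z.of_nat k) -> (-1) ^ k = 1.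
Proof.
intros [j hj]; replace k with (2 * Z.to_nat j)%nat by lia; apply pow_1_even.
Qed.

Lemma pow_opp1_odd (k : nat) : Z.Odd (Z.of_nat k) -> (-1) ^ k = -1.
Proof.
intros [j hj]; replace k with (S (2 * Z.to_nat j))%nat by lia; apply pow_1_odd.
Qed.

Lemma sign_parity (x t : Z) :
  (Z.Even (x + t) -> cos (IZR x * PI) * (-1) ^ Z.abs_nat t = 1) /\
  (Z.Odd (x + t) -> cos (IZR x * PI) * (-1) ^ Z.abs_nat t = -1).
Proof.
assert (A : forall z, Z.Even z -> Z.Even (Z.of_nat (Z.abs_nat z))).
{ intros z [k hk]; exists (Z.abs k); lia. }
assert (B : forall z, Z.Odd z -> Z.Odd (Z.of_nat (Z.abs_nat z))).
{ intros z [k hk]; destruct (Z_le_gt_dec 0 z); [exists k|exists (- k - 1)%Z]; lia. }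
destruct (Z.Even_or_Odd x) as [hx|hx], (Z.Even_or_Odd t) as [ht|ht];
  rewrite ?(cos_even_PI x), ?(cos_odd_PI x), ?(pow_opp1_even (Z.abs_nat t)),
    ?(pow_opp1_odd (Z.abs_nat t)) by auto;
  destruct hx as [a ->], ht as [b ->]; split; intros [c hc]; try lra; exfalso; lia.
Qed.

Section Parity.
Variables (n : R) (hn : 0 <= n < 1).

(** The substitution [p -> PI - p] negates [n cos p] and multiplies [cos (x p)] by [cos (x PI)]. The
    sign [s] is [(-1)^(x + t)], so one of the two parts vanishes at each point. *)
Lemma green_reflect (x t : Z) :
  let s := cos (IZR x * PI) * (-1) ^ Z.abs_nat t in
  Re (green n 0 x t) = - s * Re (green n 0 x t) /\
  Im (green n 0 x t) = s * Im (green n 0 x t).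
Proof.
intros s.
destruct (symbol_contC (Z.abs_nat t) n 0 (sym_dom_rcos n 0 hn)) as [h1 h2].
set (f := fun p => Re (symbol (Z.abs_nat t) (n * cos p) 0)) in *.
set (g := fun p => Im (symbol (Z.abs_nat t) (n * cos p) 0)) in *.
change (Re (green n 0 x t)) with (coef f x); change (Im (green n 0 x t)) with (coef g x).
assert (q : cos (IZR x * PI) * cos (IZR x * PI) = 1).
{ destruct (Z.Even_or_Odd x) as [hx|hx]; rewrite ?(cos_even_PI x hx), ?(cos_odd_PI x hx); ring. }
assert (E : forall p, symbol (Z.abs_nat t) (n * cos (PI - p)) 0 =
  (RtoC ((-1) ^ Z.abs_nat t) * ((- f p)%R, g p))%C).
{ intros p; unfold f, g; rewrite <- symbol_opp.
  replace (PI - p) with (- (p - PI)) by ring.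
  rewrite cos_neg; replace (n * cos (p - PI)) with (- (n * cos p)); [reflexivity|].
  rewrite cos_minus, cos_PI, sin_PI; ring. }
generalize (coef_reflect f x h1) (coef_reflect g x h2).
rewrite (coef_ext (fun p => f (PI - p)) (fun p => - (-1) ^ Z.abs_nat t * f p + 0 * f p)).
2: { intros p; unfold f at 1; rewrite E; unfold Re; simpl; ring. }
rewrite (coef_ext (fun p => g (PI - p)) (fun p => (-1) ^ Z.abs_nat t * g p + 0 * g p)).
2: { intros p; unfold g at 1; rewrite E; unfold Im; simpl; ring. }
rewrite !coef_lin by assumption; intros e1 e2; unfold s.
split.
- transitivity (cos (IZR x * PI) * (cos (IZR x * PI) * coef f x)); [rewrite <- Rmult_assoc, q; ring|].
  rewrite <- e1; ring.
- transitivity (cos (IZR x * PI) * (cos (IZR x * PI) * coef g x)); [rewrite <- Rmult_assoc, q; ring|].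
  rewrite <- e2; ring.
Qed.

Lemma green_Re_even (x t : Z) : Z.Even (x + t) -> Re (green n 0 x t) = 0.
Proof.
intros h; destruct (green_reflect x t) as [H _]; rewrite (proj1 (sign_parity x t) h) in H; lra.
Qed.

Lemma green_Im_odd (x t : Z) : Z.Odd (x + t) -> Im (green n 0 x t) = 0.
Proof.
intros h; destruct (green_reflect x t) as [_ H]; rewrite (proj2 (sign_parity x t) h) in H; lra.
Qed.

Definition green_re (x t : Z) : R := Re (green n 0 x t).

Lemma green_re_eq (x t : Z) :
  green_re x (t + 1) + green_re x (t - 1) - n * (green_re (x + 1) t + green_re (x - 1) t)
  = Re (point_src x t).
Proof.
rewrite <- (green_eq n 0 (sym_dom_rcos n 0 hn) x t); unfold scalar_op, green_re, Re; simpl; ring.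
Qed.

Lemma green_re_0 (x : Z) : green_re x 0 = 0.
Proof.
unfold green_re, green, ccoef, coef; simpl.
rewrite (avg_ext _ (fun _ => 0)); [apply avg_const|].
intros p; unfold symbol, sym_amp, Re; rewrite sym_im_0; simpl; ring.
Qed.

(** Evenness in [t] shares the unit source equally between times 1 and -1. Together with the zero
    values at time 0, this gives the initial data of the real recursion. *)
Lemma green_re_1 (x : Z) : green_re x 1 = if Z.eq_dec x 0 then 1 / 2 else 0.
Proof.
generalize (green_re_eq x 0); rewrite !green_re_0; unfold green_re at 2.
change (0 - 1)%Z with (- (0 + 1))%Z; rewrite green_even_t; fold (green_re x (0 + 1)).
change (0 + 1)%Z with 1%Z; unfold point_src; destruct (Z.eq_dec x 0); simpl; lra.
Qed.

Lemma green_re_opp (x t : Z) : green_re (- x) t = green_re x t.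
Proof. unfold green_re; rewrite green_even_x; reflexivity. Qed.

End Parity.

(** * Checker paths *)

Definition csum (l : list (list bool)) (P : list bool -> bool) (f : list bool -> C) : C :=
  fold_right Cplus (RtoC 0) (map f (filter P l)).

Lemma csum_app (l l' : list (list bool)) (P : list bool -> bool) (f : list bool -> C) :
  csum (l ++ l') P f = (csum l P f + csum l' P f)%C.
Proof.
unfold csum; induction l as [|a l IH]; simpl; [ring|].
destruct (P a); simpl; rewrite IH; ring.
Qed.

Lemma csum_map (l : list (list bool)) (g : list bool -> list bool) (P : list bool -> bool)
  (f : list bool -> C) :
  csum (map g l) P f = csum l (fun s => P (g s)) (fun s => f (g s)).
Proof.
unfold csum; induction l as [|a l IH]; simpl; [reflexivity|].
destruct (P (g a)); simpl; rewrite IH; reflexivity.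
Qed.

Lemma csum_ext_in (l : list (list bool)) (P Q : list bool -> bool) (f g : list bool -> C) :
  (forall s, In s l -> P s = Q s /\ f s = g s) -> csum l P f = csum l Q g.
Proof.
unfold csum; induction l as [|a l IH]; intros H; simpl; [reflexivity|].
destruct (H a (or_introl eq_refl)) as [-> e].
destruct (Q a); simpl; rewrite ?e, IH; auto; intros; apply H; right; assumption.
Qed.

Lemma csum_scal (l : list (list bool)) (P : list bool -> bool) (z : C) (f : list bool -> C) :
  csum l P (fun s => (z * f s)%C) = (z * csum l P f)%C.
Proof.
unfold csum; induction l as [|a l IH]; simpl; [ring|].
destruct (P a); simpl; rewrite IH; ring.
Qed.

Lemma csum_false (l : list (list bool)) (f : list bool -> C) : csum l (fun _ => false) f = 0%C.
Proof. unfold csum; induction l as [|a l IH]; simpl; [reflexivity|exact IH]. Qed.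

Lemma bool_lists_length (k : nat) (s : list bool) : In s (bool_lists k) -> length s = k.
Proof.
revert s; induction k as [|k IH]; simpl; intros s h.
- destruct h as [<-|[]]; reflexivity.
- apply in_app_or in h; destruct h as [h|h]; apply in_map_iff in h;
  destruct h as [r [<- hr]]; simpl; f_equal; apply IH, hr.
Qed.

(* The paths have [k + 1] steps, the first of which is [b]. *)
Definition path_sum (z : C) (b : bool) (k : nat) (X : Z) : C :=
  csum (bool_lists k) (fun s => Z.eqb (endpoint (b :: s)) X) (fun s => Cpow z (turns (b :: s))).

Lemma path_sum_0 (z : C) (b : bool) (X : Z) :
  path_sum z b 0 X = if Z.eqb (step b) X then 1%C else 0%C.
Proof.
unfold path_sum, csum; simpl; rewrite Z.add_0_r; destruct Z.eqb; simpl; [ring|reflexivity].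
Qed.

(** Paths are classified by their second step: going straight keeps the weight, a turn contributes
    one factor [z]. *)
Lemma path_sum_S (z : C) (b : bool) (k : nat) (X : Z) :
  path_sum z b (S k) X =
  (path_sum z b k (X - step b) + z * path_sum z (negb b) k (X - step b))%C.
Proof.
assert (B : forall b', csum (map (cons b') (bool_lists k)) (fun s => Z.eqb (endpoint (b :: s)) X)
   (fun s => Cpow z (turns (b :: s)))
   = (Cpow z (if Bool.eqb b b' then 0 else 1) * path_sum z b' k (X - step b))%C).
{ intros b'; rewrite csum_map; unfold path_sum; rewrite <- csum_scal.
  apply csum_ext_in; intros s _; split.
  - apply Bool.eq_iff_eq_true; rewrite !Z.eqb_eq; simpl; lia.
  - change (turns (b :: b' :: s)) with ((if Bool.eqb b b' then 0 else 1) + turns (b' :: s))%nat.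
    destruct (Bool.eqb b b'); simpl; ring. }
unfold path_sum at 1; cbn [bool_lists]; rewrite csum_app, !B.
destruct b; simpl; ring.
Qed.

Lemma path_sum_mirror (z : C) (b : bool) (k : nat) (X : Z) :
  path_sum z (negb b) k X = path_sum z b k (- X).
Proof.
revert b X; induction k as [|k IH]; intros b X.
- rewrite !path_sum_0; replace (Z.eqb (step (negb b)) X) with (Z.eqb (step b) (- X)); [reflexivity|].
  apply Bool.eq_iff_eq_true; rewrite !Z.eqb_eq; destruct b; simpl; lia.
- rewrite !path_sum_S, Bool.negb_involutive, !IH.
  replace (- (X - step (negb b)))%Z with (- X - step b)%Z by (destruct b; simpl; lia).
  replace (- (- X - step b))%Z with (X - step (negb b))%Z by (destruct b; simpl; lia).
  reflexivity.
Qed.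

Section Paths.
Variables (eps m : R) (heps : 0 < eps) (hm : 0 < m).
Let n := coupling eps m 0.
Let z := Cmult (Cmult (RtoC (-1)) Ci) (RtoC (m * eps)).

(** A path of [k + 1] steps has [k + 2] points, so the exponent is [- k / 2]. *)
Lemma path_prefactor (k : nat) :
  Rpower (1 + m ^ 2 * eps ^ 2) (1 - INR (S (S k)) / 2) = n ^ k.
Proof.
assert (hp : 0 < 1 + m ^ 2 * eps ^ 2)
  by (assert (0 <= m ^ 2 * eps ^ 2) by (apply Rmult_le_pos; apply pow2_ge_0); lra).
unfold n; rewrite coupling_0; induction k as [|k IH].
- replace (1 - INR 2 / 2) with 0 by (simpl; field); apply Rpower_O, hp.
- replace (1 - INR (S (S (S k))) / 2) with ((1 - INR (S (S k)) / 2) + - / 2)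
    by (rewrite (S_INR (S (S k))); field).
  rewrite Rpower_plus, IH, Rpower_Ropp, Rpower_sqrt by exact hp; simpl; unfold Rdiv; ring.
Qed.

Lemma checker_a_path_sum (X : Z) (k : nat) :
  checker_a X (Z.of_nat k + 1) m eps = (RtoC (n ^ k) * Ci * path_sum z true k X)%C.
Proof.
unfold checker_a; replace (Z.to_nat (Z.of_nat k + 1)) with (S k) by lia.
change (csum (bool_lists (S k)) (fun s => match s with true :: _ => Z.eqb (endpoint s) X | _ => false end)
  (path_amp m eps) = (RtoC (n ^ k) * Ci * path_sum z true k X)%C).
cbn [bool_lists]; rewrite csum_app, !csum_map, csum_false.
unfold path_sum; rewrite <- csum_scal, Cplus_0_r.
apply csum_ext_in; intros s hs; split; [reflexivity|].
unfold path_amp; cbn [length]; rewrite (bool_lists_length k s hs), path_prefactor; reflexivity.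
Qed.

(** The right-hand side pairs [kernel_a] at [X] with [kernel_b] at [X - 1], for [d = 0] and the real
    part of the kernel. In the induction the turn factor [z = - i m eps] mixes real and imaginary
    parts; the real part closes at once and the imaginary part by the wave equation. *)
Lemma checker_a_green (k : nat) (X : Z) :
  checker_a X (Z.of_nat k + 1) m eps =
  (2 * n * (m * eps) * green_re n X (Z.of_nat k),
   2 * green_re n (X - 1) (Z.of_nat k + 1) - 2 * n * green_re n X (Z.of_nat k)).
Proof.
assert (hn := coupling_0_lt1 eps m heps hm); fold n in hn.
revert X; induction k as [|k IH]; intros X.
- rewrite checker_a_path_sum, path_sum_0; change (Z.of_nat 0) with 0%Z.
  rewrite (green_re_0 n), (green_re_1 n hn).
  destruct (Z.eqb_spec (step true) X) as [h|h], (Z.eq_dec (X - 1) 0) as [h'|h']; simpl in h; try lia;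
  apply injective_projections; simpl; field.
- rewrite checker_a_path_sum, path_sum_S, path_sum_mirror.
  (* Dropping the first step moves the target to [X - 1]. A remaining path that starts to the left
     is mirrored into one that starts to the right and ends at [1 - X]. *)
  transitivity (RtoC n * (checker_a (X - 1) (Z.of_nat k + 1) m eps
    + z * checker_a (1 - X) (Z.of_nat k + 1) m eps))%C.
  + rewrite !checker_a_path_sum; change (step true) with 1%Z.
    replace (- (X - 1))%Z with (1 - X)%Z by lia; simpl pow; rewrite RtoC_mult; ring.
  + rewrite !IH.
    replace (Z.of_nat (S k)) with (Z.of_nat k + 1)%Z by lia.
    set (t := Z.of_nat k).
    generalize (green_re_eq n hn (X - 1) (t + 1)).
    replace (1 - X - 1)%Z with (- X)%Z by lia; replace (1 - X)%Z with (- (X - 1))%Z by lia.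
    rewrite !green_re_opp.
    replace (point_src (X - 1) (t + 1)) with (RtoC 0)
      by (unfold point_src; destruct (Z.eq_dec (X - 1) 0), (Z.eq_dec (t + 1) 0);
          try reflexivity; unfold t in *; lia).
    replace (t + 1 - 1)%Z with t by lia; replace (X - 1 + 1)%Z with X by lia.
    intros E; simpl in E.
    assert (q : n * n * (1 + m * eps * (m * eps)) = 1).
    { unfold n; rewrite coupling_0.
      assert (hp : 0 <= m ^ 2 * eps ^ 2) by (apply Rmult_le_pos; apply pow2_ge_0).
      replace (1 + m * eps * (m * eps)) with (sqrt (1 + m ^ 2 * eps ^ 2) * sqrt (1 + m ^ 2 * eps ^ 2))
        by (rewrite sqrt_sqrt by lra; ring).
      field; apply Rgt_not_eq, sqrt_lt_R0; lra. }
    apply injective_projections; simpl; [ring|].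
    set (L := green_re n) in *.
    (* The wave equation with its coefficient 1 written as [n^2 (1 + (m eps)^2)]: the two summands
       match the straight and the turning contribution. *)
    replace (L (X - 1)%Z (t + 1 + 1)%Z)
      with (n * (L X (t + 1)%Z + L (X - 1 - 1)%Z (t + 1)%Z)
            - n * n * (1 + m * eps * (m * eps)) * L (X - 1)%Z t) by (rewrite q; lra).
    ring.
Qed.

End Paths.

(** * Comparison of the limit with the checker amplitudes *)

Lemma green_re_abs (n : R) (x t : Z) : green_re n x (Z.abs t) = green_re n x t.
Proof.
unfold green_re; destruct (Z.abs_eq_or_opp t) as [-> | ->]; [|rewrite green_even_t]; reflexivity.
Qed.

Lemma green_odd (n : R) (x t : Z) : 0 <= n < 1 -> Z.Odd (x + t) ->
  green n 0 x t = RtoC (green_re n x t).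
Proof.
intros hn h; apply injective_projections; [reflexivity|]; exact (green_Im_odd n hn x t h).
Qed.

Lemma checker_a_abs (eps m : R) (X T : Z) : 0 < eps -> 0 < m ->
  let n := coupling eps m 0 in
  a1 X (Z.abs T + 1) m eps = 2 * n * (m * eps) * green_re n X T /\
  a2 X (Z.abs T + 1) m eps = 2 * green_re n (X - 1) (Z.abs T + 1) - 2 * n * green_re n X T.
Proof.
intros he hm n; unfold a1, a2; rewrite <- Zabs2Nat.id_abs, checker_a_green by assumption.
rewrite Zabs2Nat.id_abs; fold n; rewrite green_re_abs; split; reflexivity.
Qed.

Theorem theorem1 (eps m : R) (heps : 0 < eps) (hm : 0 < m) :
  (* existence and uniqueness (on L_eps) for each delta in (0,1) *)
  (forall delta : R, 0 < delta < 1 ->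
     exists A1 A2 : R -> R -> C,
       axioms eps m delta A1 A2 /\
       forall B1 B2 : R -> R -> C, axioms eps m delta B1 B2 ->
         forall X T : Z, Z.Even (X + T) ->
           B1 (hc eps X) (hc eps T) = A1 (hc eps X) (hc eps T) /\
           B2 (hc eps X) (hc eps T) = A2 (hc eps X) (hc eps T)) /\
  (* limits as delta decreases to 0, at points (x,t) = (eps X, eps T) of eps Z^2 *)
  (forall A1 A2 : R -> R -> R -> C,
     (forall delta : R, 0 < delta < 1 -> axioms eps m delta (A1 delta) (A2 delta)) ->
     forall X T : Z,
       (exists L1 : C,
          filterlim (fun delta => A1 delta (eps * IZR X) (eps * IZR T)) (at_right 0) (locally L1) /\
          (Z.Odd (X + T) -> L1 = RtoC (a1 X (Z.abs T + 1) m eps)) /\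
          (Z.Even (X + T) -> Re L1 = 0)) /\
       (exists L2 : C,
          filterlim (fun delta => A2 delta (eps * IZR X) (eps * IZR T)) (at_right 0) (locally L2) /\
          (Z.Even (X + T) -> (0 <= T)%Z -> L2 = RtoC (a2 (X + 1) (Z.abs T + 1) m eps)) /\
          (Z.Even (X + T) -> (T < 0)%Z -> L2 = RtoC (- a2 (- X + 1) (Z.abs T + 1) m eps)) /\
          (Z.Odd (X + T) -> Re L2 = 0))).
Proof.
split.
- intros d hd; eexists; eexists; split; [apply (solution_axioms eps m d heps hm hd)|].
  intros B1 B2 HB; apply (axioms_odd_unique eps m d B1 B2 _ _ HB (solution_axioms eps m d heps hm hd)).
  apply (axioms_lattice_unique eps m d heps hd B1 B2 _ _ hm HB (solution_axioms eps m d heps hm hd)).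
- intros A1 A2 HA X T.
  destruct (solution_limit eps m X T heps hm) as [La Lb].
  generalize (coupling_0_lt1 eps m heps hm) (fun x t => checker_a_abs eps m x t heps hm); cbv zeta.
  set (n := coupling eps m 0) in *; intros hn ha.
  assert (near : at_right 0 (fun d => 0 < d < 1)).
  { exists (mkposreal 1 Rlt_0_1); intros d hb hd0.
    change (Rabs (d - 0) < 1) in hb; apply Rabs_lt_between in hb; lra. }
  (* The given family is known to solve the axioms only for [0 < d < 1], so it agrees with the
     explicit solution eventually, which is all that the limit sees. *)
  assert (E : at_right 0 (fun d => solution_a eps m d X T = A1 d (eps * IZR X) (eps * IZR T) /\
                                   solution_b eps m d X T = A2 d (eps * IZR X) (eps * IZR T))).
  { revert near; apply filter_imp; intros d hd.
    destruct (solution_unique eps m d heps hm hd _ _ (HA d hd) X T) as [h1 h2].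
    split; symmetry; assumption. }
  split.
  + exists (kernel_a n (m * eps) 0 (green n 0) X T); split; [|split].
    * revert La; apply filterlim_ext_loc; revert E; apply filter_imp; tauto.
    * intros h; rewrite (proj1 (ha X T)); unfold kernel_a; rewrite (green_odd n X T hn h), !RtoC_mult; ring.
    * intros h; generalize (green_Re_even n hn X T h); unfold kernel_a, Re; simpl; intros ->; ring.
  (* The second component reads the kernel at [(X, T + 1)] and [(X + 1, T)], both of parity opposite
     to [(X, T)]. *)
  + assert (odd1 : forall a, Z.Even (X + T) -> (a = 1 \/ a = -1)%Z -> Z.Odd (X + (T + a)) /\ Z.Odd (X + a + T)).
    { intros a [k hk] [-> | ->]; split; [exists k|exists k|exists (k - 1)%Z|exists (k - 1)%Z]; lia. }
    exists (kernel_b n (m * eps) 0 (green n 0) X T); split; [|split; [|split]].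
    * revert Lb; apply filterlim_ext_loc; revert E; apply filter_imp; tauto.
    * intros h ht; rewrite (proj2 (ha (X + 1)%Z T)), (Z.abs_eq T ht); unfold kernel_b.
      destruct (odd1 1%Z h (or_introl eq_refl)) as [o1 o2].
      rewrite (green_odd n X (T + 1) hn o1), (green_odd n (X + 1) T hn o2).
      replace (X + 1 - 1)%Z with X by lia.
      rewrite RtoC_minus, !RtoC_mult; ring.
    * intros h ht; rewrite (proj2 (ha (- X + 1)%Z T)), (Z.abs_neq T) by lia; unfold kernel_b.
      destruct (odd1 1%Z h (or_introl eq_refl)) as [o1 o2].
      rewrite (green_odd n X (T + 1) hn o1), (green_odd n (X + 1) T hn o2).
      replace (- X + 1 - 1)%Z with (- X)%Z by lia; replace (- X + 1)%Z with (- (X - 1))%Z by lia.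
      rewrite !green_re_opp; replace (- T + 1)%Z with (- (T - 1))%Z by lia.
      replace (green_re n X (- (T - 1))) with (green_re n X (T - 1))
        by (unfold green_re; rewrite green_even_t; reflexivity).
      (* For [T < 0] there is no source, and the wave equation trades [(X, T + 1)], [(X + 1, T)] for
         [(X, T - 1)], [(X - 1, T)] with opposite sign: this is the origin of both minus signs. *)
      generalize (green_re_eq n hn X T).
      replace (point_src X T) with (RtoC 0)
        by (unfold point_src; destruct (Z.eq_dec X 0), (Z.eq_dec T 0); try reflexivity; lia).
      intros e; simpl in e.
      apply injective_projections; simpl; [lra|ring].
    * intros h.
      assert (e1 : Z.Even (X + (T + 1))) by (destruct h as [k hk]; exists (k + 1)%Z; lia).
      assert (e2 : Z.Even (X + 1 + T)) by (destruct h as [k hk]; exists (k + 1)%Z; lia).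
      generalize (green_Re_even n hn _ _ e1) (green_Re_even n hn _ _ e2).
      unfold kernel_b, Re; simpl; intros -> ->; ring.
Qed.
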